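(* Let $H$ be a complex Hilbert space, $\lambda\in[0,1]$, $T\in\mathcal{B}(H)$, and let $n$ be a natural number. The following assertions are equivalent: (i) $T$ is normaloid; (ii) there exists $\theta\in\mathbb{R}$ such that, for all invertible $X\in\mathcal{B}(H)$, $\|T\|\le w(\operatorname{Re}(\Delta_\lambda^n(e^{i\theta}XTX^{-1})))$; (iii) there exists $\theta\in\mathbb{R}$ such that, for all invertible $X\in\mathcal{B}(H)$, $\|T\|\le\|\operatorname{Re}(\Delta_\lambda^n(e^{i\theta}XTX^{-1}))\|$.
   Context: $H$ is a (nonzero) complex Hilbert space, $\mathcal{B}(H)$ is the space of bounded linear operators on $H$ with the operator norm $\|\cdot\|$, and $r(T)$ is the spectral radius of $T$. An operator $T$ is normaloid if $r(T)=\|T\|$. For $S\in\mathcal{B}(H)$, $\operatorname{Re}(S)=\frac12(S+S^* )$. The numerical range of $S$ is $W(S)=\{\langle Sx,x\rangle : \|x\|=1\}$ and its numerical radius is $w(S)=\sup\{|\mu| : \mu\in W(S)\}$. For $T\in\mathcal{B}(H)$, $|T|=(T^*T)^{1/2}$ and $T=U|T|$ is the unique polar decomposition, with $U$ the partial isometry satisfying $\ker U=\ker T$. For $\lambda\in[0,1]$ the $\lambda$-Aluthge transform is $\Delta_\lambda(T)=|T|^{\lambda}U|T|^{1-\lambda}$, with the convention $|T|^0=I$, so that $\Delta_0(T)=U|T|=T$ and $\Delta_1(T)=|T|U$. Its iterates are $\Delta_\lambda^0(T)=T$ and $\Delta_\lambda^{n+1}(T)=\Delta_\lambda(\Delta_\lambda^n(T))$.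 Natural numbers include $0$. *)

(* Defs.v *)
From HB Require Import structures.
From mathcomp Require Import all_boot all_order all_algebra.
From mathcomp Require Import sesquilinear complex.
From mathcomp Require Import all_classical all_reals all_analysis.

Set Implicit Arguments.
Unset Strict Implicit.
Unset Printing Implicit Defensive.

Import Order.TTheory GRing.Theory Num.Theory.
Import numFieldNormedType.Exports.

Local Open Scope classical_set_scope.
Local Open Scope complex_scope.
Local Open Scope ring_scope.

(* A dot form is linear in its first argument and conjugate-linear in the
   second one. *)
HB.mixin Record CompleteNormedModule_isHilbert (R : realType) H
    of CompleteNormedModule R[i] H := {
  inner : {dot H for (@Num.conj R[i])} ;
  sqr_norm_inner : forall x : H, `|x| ^+ 2 = inner x x
}.

#[short(type="hilbertType")]
HB.structure Definition Hilbert (R : realType) :=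
  {H of CompleteNormedModule R[i] H & CompleteNormedModule_isHilbert R H}.

(* The library norm of a module over R[i] takes its values in R[i]; this is the
   same norm with values in R, as needed for suprema. *)
Definition rnorm (R : realType) (V : normedZmodType R[i]) (x : V) : R :=
  complex.Re `|x|.

Section Operators.
Variables (R : realType) (H : hilbertType R).
Implicit Types (S T U A X : H -> H) (x y : H) (z : R[i]).

(* Operators are bare functions, with pointwise addition and scaling, and
   composition as product; bounded_op is the set B(H). *)
Definition bounded_op : set (H -> H) :=
  [set T | linear T /\ exists M : R, forall x, rnorm (T x) <= M * rnorm x].

Definition opnorm T : R := sup [set rnorm (T x) | x in [set x | rnorm x <= 1]].

Definition adjoint T : H -> H :=
  xget 0 [set S | bounded_op S /\ forall x y, inner (T x) y = inner x (S y)].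

Definition inverse_ops X Y : Prop :=
  [/\ bounded_op X, bounded_op Y, X \o Y = idfun & Y \o X = idfun].

Definition spectrum T : set R[i] :=
  [set z | ~ exists Y, inverse_ops (T - z *: (idfun : H -> H)) Y].

Definition spectral_radius T : R := sup [set rnorm z | z in spectrum T].

Definition normaloid T : Prop := spectral_radius T = opnorm T.

Definition real_part S : H -> H := (2^-1 : R[i]) *: (S + adjoint S).

Definition numerical_range S : set R[i] :=
  [set inner (S x) x | x in [set x | rnorm x = 1]].

Definition numerical_radius S : R := sup [set rnorm z | z in numerical_range S].

Definition poly_op (p : {poly R[i]}) A : H -> H :=
  fun x => \sum_(k < size p) p`_k *: iter k A x.

(* A^s for a positive operator A, by continuous functional calculus: the norm
   limit of p_k(A) for polynomials p_k converging to t |-> t^s uniformly on the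
   spectrum of A. As 0 `^ 0 = 1, this gives A^0 = I, also when A is not
   injective. *)
Definition op_pow A (s : R) : H -> H :=
  xget 0 [set B | bounded_op B /\ exists p : nat -> {poly R[i]},
    {uniform spectrum A, (fun k z => (p k).[z] : R[i]^o) @ \oo -->
                         (fun z => (complex.Re z `^ s)%:C : R[i]^o)} /\
    opnorm (poly_op (p k) A - B) @[k --> \oo] --> (0 : R)].

Definition abs_op T : H -> H := op_pow (adjoint T \o T) 2^-1.

Definition partial_isometry U : Prop :=
  forall x, (forall y, U y = 0 -> inner x y = 0) -> rnorm (U x) = rnorm x.

Definition polar_factor T : H -> H :=
  xget 0 [set U | [/\ bounded_op U, partial_isometry U, T = U \o abs_op T
                    & forall x, U x = 0 <-> T x = 0]].

Definition aluthge (lambda : R) T : H -> H :=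
  op_pow (abs_op T) lambda \o polar_factor T \o op_pow (abs_op T) (1 - lambda).

End Operators.

Definition expi (R : realType) (theta : R) : R[i] := cos theta +i* sin theta.

(* Main.v *)
(** The Aluthge transform neither increases the norm nor loses a nonzero
    spectral value: T and its transform are the products in both orders of
    |T|^lambda and U|T|^(1-lambda).

    If T is normaloid, some z in its spectrum has modulus |T|; rotating z to |T|,
    the number |T| remains in the spectrum after a similarity and n transforms,
    and a real spectral value r of S satisfies r <= w(Re S), since otherwise
    r - S is coercive, hence invertible.

    Conversely, (iii) gives |T| <= |X T X^-1| for every invertible X. If c exceeds
    the spectral radius, then the powers of T/c become small, by averaging the
    resolvent over roots of unity of order 2^k (no holomorphy is needed), and Rota's
    renorming gives an X with |X T X^-1| <= c; thus |T| <= r(T).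

    Powers of a positive operator A are well defined because
    |p(A)| <= sup |p| on the spectrum of A for every polynomial p. *)
Require Import Defs.
From mathcomp Require Import all_boot all_order all_algebra.
From mathcomp Require Import sesquilinear complex ring lra.
From mathcomp Require Import all_classical all_reals all_analysis.

Set Implicit Arguments.
Unset Strict Implicit.
Unset Printing Implicit Defensive.

Import Order.TTheory GRing.Theory Num.Theory.
Import numFieldNormedType.Exports.

Local Open Scope classical_set_scope.
Local Open Scope complex_scope.
Local Open Scope ring_scope.

(** * Norm, inner product and bounded operators *)

(** The adjoint, the powers and the polar factor are choices with default value 0, so each becomes
    usable only after an existence proof, and a power only through polynomials that approximate it.
    In (iii) everything but X can be stripped off, because taking real parts, the Aluthge transform
    and a rotation do not increase the norm. The obstacle is the converse, which rests on the
    spectral radius formula. For |u| = 1, the average of (1 - v T)^-1 over the 2^k-th roots v of u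
    is (1 - u T^(2^k))^-1, so one Lipschitz constant of the resolvent on the closed disc serves for
    all k. A fixed number of small steps in the radius then leads from 0, where powers vanish, to 1.
    The outcome is a single power of norm at most 1, which suffices because Rota's norm is then a
    finite sum. That a normaloid T has spectrum on the circle |z| = |T| is a matter of compactness:
    otherwise the resolvent would be bounded on the circle, and the spectral radius strictly below
    |T|. *)

Section Norm.
Variable R : realType.
Implicit Types (z w : R[i]) (r : R).

Section Abstract.
Variable V : normedZmodType R[i].
Implicit Types x y : V.

Lemma rnormE x : `|x| = (rnorm x)%:C.
Proof. by rewrite /rnorm RRe_real ?normr_real. Qed.

Lemma rnorm_ge0 x : 0 <= rnorm x.
Proof. by rewrite -lecR -rnormE normr_ge0. Qed.

Lemma rnorm0 : rnorm (0 : V) = 0.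
Proof. by rewrite /rnorm normr0. Qed.

Lemma rnormN x : rnorm (- x) = rnorm x.
Proof. by rewrite /rnorm normrN. Qed.

Lemma rnorm_eq0 x : rnorm x = 0 -> x = 0.
Proof. by move=> h; apply/normr0_eq0; rewrite rnormE h. Qed.

Lemma ler_rnormD x y : rnorm (x + y) <= rnorm x + rnorm y.
Proof. by rewrite -lecR rmorphD /= -!rnormE ler_normD. Qed.

Lemma ler_rnormB x y : rnorm (x - y) <= rnorm x + rnorm y.
Proof. by rewrite -(rnormN y) ler_rnormD. Qed.

Lemma rnorm_distC x y : rnorm (x - y) = rnorm (y - x).
Proof. by rewrite -rnormN opprB. Qed.

Lemma ler_rnorm_distD y x (w : V) : rnorm (x - w) <= rnorm (x - y) + rnorm (y - w).
Proof. by rewrite -lecR rmorphD /= -!rnormE ler_distD. Qed.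

Lemma ler_rnorm_sum (I : Type) (s : seq I) (F : I -> V) :
  rnorm (\sum_(i <- s) F i) <= \sum_(i <- s) rnorm (F i).
Proof.
elim/big_ind2 : _ => // [|x r y t hx hy]; first by rewrite rnorm0.
exact: le_trans (ler_rnormD _ _) (lerD hx hy).
Qed.

End Abstract.

Lemma rnormM z w : rnorm (z * w) = rnorm z * rnorm w.
Proof. by apply: complexI; rewrite rmorphM /= -!rnormE normrM. Qed.

Lemma rnorm1 : rnorm (1 : R[i]) = 1.
Proof. by apply: complexI; rewrite -!rnormE normr1. Qed.

Lemma rnormX z n : rnorm (z ^+ n) = rnorm z ^+ n.
Proof. by apply: complexI; rewrite rmorphXn /= -!rnormE normrX. Qed.

Lemma rnormV z : rnorm z^-1 = (rnorm z)^-1.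
Proof. by apply: complexI; rewrite fmorphV /= -!rnormE normfV. Qed.

Lemma sqr_rnormc z : rnorm z ^+ 2 = complex.Re z ^+ 2 + complex.Im z ^+ 2.
Proof. by apply: complexI; rewrite rmorphXn /= -rnormE add_Re2_Im2. Qed.

Lemma rnorm_real r : rnorm r%:C = `|r|.
Proof.
apply/eqP; rewrite -(@eqrXn2 _ 2) ?rnorm_ge0 ?normr_ge0 // sqr_rnormc /=.
by rewrite real_normK ?num_real // expr0n addr0.
Qed.

Lemma rnormc_conj z : rnorm z^*%C = rnorm z.
Proof. by rewrite /rnorm normcJ. Qed.

Lemma normr_Re_le z : `|complex.Re z| <= rnorm z.
Proof. by have := normc_ge_Re z; rewrite rnormE lecR. Qed.

Lemma Re_le_rnorm z : complex.Re z <= rnorm z.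
Proof. exact: le_trans (ler_norm _) (normr_Re_le z). Qed.

Lemma mulc_conj z : z * z^*%C = (rnorm z ^+ 2)%:C.
Proof. by rewrite -sqr_normc rnormE rmorphXn. Qed.

Lemma ReD z w : complex.Re (z + w) = complex.Re z + complex.Re w.
Proof. by case: z w => [a b] [c d]. Qed.

Lemma ReN z : complex.Re (- z) = - complex.Re z.
Proof. by case: z. Qed.

Lemma ReZ r z : complex.Re (r%:C * z) = r * complex.Re z.
Proof. by case: z => a b /=; rewrite mul0r subr0. Qed.

Lemma Re_conj z : complex.Re z^*%C = complex.Re z.
Proof. by case: z. Qed.

End Norm.

Section Inner.
Variables (R : realType) (H : hilbertType R).
Implicit Types (x y v : H) (z : R[i]) (r : R).

Lemma rnormZ z x : rnorm (z *: x) = rnorm z * rnorm x.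
Proof. by apply: complexI; rewrite rmorphM /= -!rnormE normrZ. Qed.

Lemma innerDl x y v : inner (x + y) v = inner x v + inner y v.
Proof. exact: linearDl. Qed.

Lemma innerBl x y v : inner (x - y) v = inner x v - inner y v.
Proof. exact: linearBl. Qed.

Lemma innerZl z x v : inner (z *: x) v = z * inner x v.
Proof. exact: linearZl_LR. Qed.

Lemma inner0l v : inner 0 v = 0.
Proof. exact: linear0l. Qed.

Lemma innerC x y : inner x y = (inner y x)^*%C.
Proof. by have := hermC (@inner R H) x y; rewrite expr0 mul1r. Qed.

Lemma innerDr x y v : inner v (x + y) = inner v x + inner v y.
Proof. exact: linearDr. Qed.

Lemma innerNr x v : inner v (- x) = - inner v x.
Proof. exact: linearNr. Qed.

Lemma innerBr x y v : inner v (x - y) = inner v x - inner v y.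
Proof. exact: linearBr. Qed.

Lemma innerZr z x v : inner v (z *: x) = z^*%C * inner v x.
Proof. by rewrite innerC innerZl rmorphM /= -innerC. Qed.

Lemma inner0r v : inner v 0 = 0.
Proof. exact: linear0r. Qed.

Lemma inner_sqr x : inner x x = (rnorm x ^+ 2)%:C.
Proof. by rewrite -sqr_norm_inner rnormE rmorphXn. Qed.

Lemma sqr_rnorm x : rnorm x ^+ 2 = complex.Re (inner x x).
Proof. by rewrite inner_sqr. Qed.

Lemma Re_innerC x y : complex.Re (inner x y) = complex.Re (inner y x).
Proof. by rewrite innerC Re_conj. Qed.

Lemma sqr_rnormD x y :
  rnorm (x + y) ^+ 2 = rnorm x ^+ 2 + 2 * complex.Re (inner x y) + rnorm y ^+ 2.
Proof.
rewrite !sqr_rnorm innerDl !innerDr !ReD (Re_innerC y x); ring.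
Qed.

Lemma sqr_rnormB x y :
  rnorm (x - y) ^+ 2 = rnorm x ^+ 2 - 2 * complex.Re (inner x y) + rnorm y ^+ 2.
Proof. by rewrite sqr_rnormD rnormN innerNr ReN mulrN. Qed.

(** Both vectors are brought to length |x| |y|; expanding the square of the norm of |y| x - |x| y
    gives the bound multiplied by |x| |y|. *)
Lemma Re_inner_le x y : complex.Re (inner x y) <= rnorm x * rnorm y.
Proof.
have [x0|x0] := eqVneq (rnorm x) 0.
  by rewrite (rnorm_eq0 x0) inner0l rnorm0 mul0r.
have [y0|y0] := eqVneq (rnorm y) 0.
  by rewrite (rnorm_eq0 y0) inner0r rnorm0 mulr0.
have xy0 : 0 < rnorm x * rnorm y by rewrite mulr_gt0 // lt_def rnorm_ge0 ?x0 ?y0.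
have := sqr_ge0 (rnorm ((rnorm y)%:C *: x - (rnorm x)%:C *: y)).
rewrite sqr_rnormB innerZl innerZr conjc_real mulrA -rmorphM /= ReZ.
rewrite !rnormZ !rnorm_real !ger0_norm ?rnorm_ge0 // => h.
rewrite -(ler_pM2l xy0); nra.
Qed.

(** Multiplying x by the conjugate of <x, y> makes the inner product real. *)
Lemma rnorm_inner_le x y : rnorm (inner x y) <= rnorm x * rnorm y.
Proof.
have [i0|i0] := eqVneq (rnorm (inner x y)) 0.
  by rewrite i0 mulr_ge0 ?rnorm_ge0.
have ip : 0 < rnorm (inner x y) by rewrite lt_def i0 rnorm_ge0.
have := Re_inner_le ((inner x y)^*%C *: x) y.
rewrite innerZl mulrC mulc_conj rnormZ rnormc_conj /= -mulrA expr2.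
by rewrite ler_pM2l.
Qed.

Lemma inner_ext x y : (forall v, inner x v = inner y v) -> x = y.
Proof.
move=> h; apply/eqP; rewrite -subr_eq0; apply/eqP; apply: rnorm_eq0.
apply/eqP; rewrite -sqrf_eq0 sqr_rnorm innerBl h subrr /=; exact/eqP.
Qed.

Lemma rnorm_le_sqr x r : 0 <= r -> rnorm x ^+ 2 <= r ^+ 2 -> rnorm x <= r.
Proof. by move=> r0; rewrite ler_pXn2r ?nnegrE ?rnorm_ge0. Qed.

(** The library norm has values in R[i]; this transfers its completeness to real bounds. *)
Lemma rnorm_cauchy (u : nat -> H) :
  (forall e, 0 < e -> exists N, forall m n, (N <= m)%N -> (N <= n)%N ->
     rnorm (u m - u n) < e) ->
  exists l, forall e, 0 < e -> exists N, forall n, (N <= n)%N ->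
     rnorm (u n - l) < e.
Proof.
move=> hu.
have /cauchy_cvg cu : cauchy (u @ \oo).
  apply/cauchy_ballP => e e0.
  have e1 : 0 < complex.Re e by move: e0; rewrite ltcE => /andP[].
  have eE : e = (complex.Re e)%:C by rewrite RRe_real // gtr0_real.
  have [N hN] := hu _ e1.
  exists (u @` [set n | (N <= n)%N], u @` [set n | (N <= n)%N]) => /=.
    split; exists N => // n /= hn; exact: imageP.
  move=> [a b] /= [[m hm <-] [n hn <-]].
  by rewrite -ball_normE /ball_ /= rnormE eE ltcR; apply: hN.
exists (lim (u @ \oo)) => e e0.
have ec : 0 < e%:C :> R[i] by rewrite ltcR.
have /cvgrPdist_lt /(_ _ ec) [N _ hN] := cu.
by exists N => n hn; have := hN n hn; rewrite distrC rnormE ltcR.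
Qed.

Lemma rnorm_small_eq0 x : (forall e, 0 < e -> rnorm x <= e) -> x = 0.
Proof.
move=> h; apply: rnorm_eq0; apply: le_anti; rewrite rnorm_ge0 andbT.
by apply/ler_addgt0Pr => e e0; rewrite add0r h.
Qed.

End Inner.

Section Operators.
Variables (R : realType) (H : hilbertType R).
Implicit Types (S T A X Y : H -> H) (x y : H) (z : R[i]) (r M : R).

Lemma linop_add T x y : linear T -> T (x + y) = T x + T y.
Proof. by move=> h; rewrite -[x in LHS]scale1r h scale1r. Qed.

Lemma linop0 T : linear T -> T 0 = 0.
Proof.
by move=> h; apply: (addrI (T 0)); rewrite -linop_add // !addr0.
Qed.

Lemma linop_scale T z x : linear T -> T (z *: x) = z *: T x.
Proof. by move=> h; rewrite -[_ *: x]addr0 h linop0 // addr0. Qed.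

Lemma linop_opp T x : linear T -> T (- x) = - T x.
Proof. by move=> h; rewrite -scaleN1r linop_scale // scaleN1r. Qed.

Lemma linop_sub T x y : linear T -> T (x - y) = T x - T y.
Proof. by move=> h; rewrite linop_add // linop_opp. Qed.

Lemma linop_sum T (I : Type) (s : seq I) (F : I -> H) : linear T ->
  T (\sum_(i <- s) F i) = \sum_(i <- s) T (F i).
Proof.
move=> h; exact: (big_morph T (fun x y => linop_add x y h) (linop0 h)).
Qed.

Lemma opnorm_has_sup T : bounded_op T ->
  has_sup [set rnorm (T x) | x in [set x : H | rnorm x <= 1]].
Proof.
move=> [lT [M hM]]; split; first by exists (rnorm (T 0)), 0; rewrite //= rnorm0.
exists `|M| => _ [x /= hx <-]; apply: le_trans (hM x) _.
have := ler_norm M; have := rnorm_ge0 x; have := normr_ge0 M; nra.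
Qed.

Lemma opnorm_ge0 T : 0 <= opnorm T.
Proof.
have [hs|hs] := pselect (has_sup [set rnorm (T x) | x in [set x : H | rnorm x <= 1]]).
  have [_ bs] := hs.
  apply: le_trans (rnorm_ge0 (T 0)) _; apply: (ub_le_sup bs).
  by exists 0; rewrite //= rnorm0.
(* If the values of [T] on the unit ball are unbounded, the supremum takes its default value 0. *)
by rewrite /opnorm sup_out.
Qed.

Lemma opnorm_ub T x : bounded_op T -> rnorm (T x) <= opnorm T * rnorm x.
Proof.
move=> bT; have [lT _] := bT.
have [x0|x0] := eqVneq (rnorm x) 0.
  by rewrite (rnorm_eq0 x0) linop0 // !rnorm0 mulr0.
have xp : 0 < rnorm x by rewrite lt_def x0 rnorm_ge0.
have [_ bs] := opnorm_has_sup bT.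
have : rnorm (T (((rnorm x)^-1)%:C *: x)) <= opnorm T.
  apply: (ub_le_sup bs); exists (((rnorm x)^-1)%:C *: x) => //=.
  by rewrite rnormZ rnorm_real ger0_norm ?invr_ge0 ?rnorm_ge0 // mulVf.
rewrite linop_scale // rnormZ rnorm_real ger0_norm ?invr_ge0 ?rnorm_ge0 //.
by rewrite mulrC ler_pdivrMr.
Qed.

Lemma opnorm_le T M : 0 <= M -> (forall x, rnorm (T x) <= M * rnorm x) ->
  opnorm T <= M.
Proof.
move=> M0 hM; apply: ge_sup; first by exists (rnorm (T 0)), 0; rewrite //= rnorm0.
move=> _ [x /= hx <-]; apply: le_trans (hM x) _.
by rewrite ler_piMr.
Qed.

Lemma bounded_lin T : bounded_op T -> linear T. Proof. by case. Qed.

Lemma bounded_id : bounded_op (idfun : H -> H).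
Proof. by split=> //; exists 1 => x /=; rewrite mul1r. Qed.

Lemma bounded_zero : bounded_op (0 : H -> H).
Proof.
have E x : (0 : H -> H) x = 0 by [].
split; first by move=> a x y; rewrite !E scaler0 addr0.
by exists 0 => x; rewrite E rnorm0 mul0r.
Qed.

Lemma bounded_comp S T : bounded_op S -> bounded_op T -> bounded_op (S \o T).
Proof.
move=> bS bT; have [lS _] := bS; have [lT _] := bT.
split; first by move=> a x y /=; rewrite lT lS.
exists (opnorm S * opnorm T) => x /=; apply: le_trans (opnorm_ub _ bS) _.
by rewrite -mulrA ler_wpM2l ?opnorm_ge0 ?opnorm_ub.
Qed.

Lemma opnorm_comp S T : bounded_op S -> bounded_op T ->
  opnorm (S \o T) <= opnorm S * opnorm T.
Proof.
move=> bS bT; apply: opnorm_le => [|x /=]; first by rewrite mulr_ge0 ?opnorm_ge0.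
apply: le_trans (opnorm_ub _ bS) _.
by rewrite -mulrA ler_wpM2l ?opnorm_ge0 ?opnorm_ub.
Qed.

Lemma bounded_add S T : bounded_op S -> bounded_op T -> bounded_op (S + T).
Proof.
move=> bS bT; have [lS _] := bS; have [lT _] := bT.
split.
  by move=> a x y; rewrite !fctE lT lS scalerDr addrACA.
exists (opnorm S + opnorm T) => x; rewrite fctE mulrDl.
by apply: le_trans (ler_rnormD _ _) _; apply: lerD; apply: opnorm_ub.
Qed.

Lemma opnorm_add S T : bounded_op S -> bounded_op T ->
  opnorm (S + T) <= opnorm S + opnorm T.
Proof.
move=> bS bT; apply: opnorm_le => [|x /=]; first by rewrite addr_ge0 ?opnorm_ge0.
rewrite fctE mulrDl.
by apply: le_trans (ler_rnormD _ _) _; apply: lerD; apply: opnorm_ub.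
Qed.

Lemma bounded_scale z T : bounded_op T -> bounded_op (z *: T).
Proof.
move=> bT; have [lT _] := bT.
split.
  by move=> a x y; rewrite !fctE lT scalerDr !scalerA mulrC.
by exists (rnorm z * opnorm T) => x; rewrite fctE rnormZ -mulrA ler_wpM2l ?rnorm_ge0 ?opnorm_ub.
Qed.

Lemma opnorm_scale z T : bounded_op T -> opnorm (z *: T) <= rnorm z * opnorm T.
Proof.
move=> bT; apply: opnorm_le => [|x]; first by rewrite mulr_ge0 ?opnorm_ge0 ?rnorm_ge0.
by rewrite fctE rnormZ -mulrA ler_wpM2l ?rnorm_ge0 ?opnorm_ub.
Qed.

Lemma bounded_opp T : bounded_op T -> bounded_op (- T).
Proof. by rewrite -scaleN1r; apply: bounded_scale. Qed.

Lemma bounded_sub S T : bounded_op S -> bounded_op T -> bounded_op (S - T).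
Proof. by move=> bS bT; apply: bounded_add => //; apply: bounded_opp. Qed.

Lemma bounded_iter T n : bounded_op T -> bounded_op (iter n T).
Proof.
move=> bT; elim: n => [|n ih]; first exact: bounded_id.
exact: (bounded_comp bT ih).
Qed.

End Operators.

(** * Invertibility *)

Section Invertible.
Variables (R : realType) (H : hilbertType R).
Implicit Types (S T A B D E X Y : H -> H) (x y : H) (z : R[i]) (r M : R).
Local Notation Id := (idfun : H -> H).

Lemma expr_lt_eps (q C e : R) : 0 <= q < 1 -> 0 < e ->
  exists N, forall n, (N <= n)%N -> q ^+ n * C < e.
Proof.
move=> /andP[q0 q1] e0.
have : q ^+ n * C @[n --> \oo] --> 0 * C.
  by apply: cvgMl; apply: cvg_expr; rewrite ger0_norm.
rewrite mul0r => /cvgrPdist_lt /(_ _ e0) [N _ hN].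
exists N => n hn; have := hN n hn; rewrite sub0r normrN; apply: le_lt_trans.
exact: ler_norm.
Qed.

Lemma inverse_sym X Y : inverse_ops X Y -> inverse_ops Y X.
Proof. by case. Qed.

Lemma inverse_comp X X' Y Y' : inverse_ops X X' -> inverse_ops Y Y' ->
  inverse_ops (X \o Y) (Y' \o X').
Proof.
move=> [bX bX' h1 h2] [bY bY' h3 h4]; split; try exact: bounded_comp.
  by rewrite compA -(compA X) h3.
by rewrite compA -(compA Y') h2.
Qed.

Lemma inverse_scale z X Y : z != 0 -> inverse_ops X Y ->
  inverse_ops (z *: X) (z^-1 *: Y).
Proof.
move=> z0 [bX bY h1 h2]; split; try exact: bounded_scale.
  apply/funext => x; rewrite /= !fctE (linop_scale _ _ (bounded_lin bX)).
  by rewrite scalerA divff // scale1r -[X _]/((X \o Y) x) h1.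
apply/funext => x; rewrite /= !fctE (linop_scale _ _ (bounded_lin bY)).
by rewrite scalerA mulVf // scale1r -[Y _]/((Y \o X) x) h2.
Qed.

Lemma inverse_bounded_below X Y x : inverse_ops X Y ->
  rnorm x <= opnorm Y * rnorm (X x).
Proof.
move=> [bX bY h1 h2]; have xE : x = Y (X x) by rewrite -[Y _]/((Y \o X) x) h2.
by rewrite {1}xE opnorm_ub.
Qed.

(** The lower bound supplies both injectivity and the bound on the inverse, so no open mapping
    theorem enters. *)
Lemma inverse_of_bijective D (K : R) : bounded_op D -> 0 <= K ->
  (forall y, exists x, D x = y) -> (forall x, rnorm x <= K * rnorm (D x)) ->
  exists2 Y, inverse_ops D Y & opnorm Y <= K.
Proof.
move=> bD K0 surj bel; have lD := bounded_lin bD.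
have [Y hY] := choice surj.
have inj x y : D x = D y -> x = y.
  move=> h; apply/eqP; rewrite -subr_eq0; apply/eqP/rnorm_eq0/le_anti.
  by rewrite rnorm_ge0 andbT (le_trans (bel _)) // linop_sub // h subrr rnorm0 mulr0.
have bdY x : rnorm (Y x) <= K * rnorm x by rewrite -{2}(hY x).
exists Y; last exact: opnorm_le.
split=> //.
- split; last by exists K.
  by move=> a x y; apply: inj; rewrite lD !hY.
- by apply/funext => x /=; exact: hY.
- by apply/funext => x; apply: inj; rewrite /= hY.
Qed.

(** Surjectivity comes from iterating x |-> y + E x from 0, which yields the partial sums of the
    Neumann series; the lower bound is |x - E x| >= (1 - q) |x|. *)
Lemma neumann E (q : R) : bounded_op E -> 0 <= q < 1 ->
  (forall x, rnorm (E x) <= q * rnorm x) ->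
  exists2 Y, inverse_ops (Id - E) Y & opnorm Y <= (1 - q)^-1.
Proof.
move=> bE /andP[q0 q1] hE; have lE := bounded_lin bE.
have q2 : 0 < 1 - q by rewrite subr_gt0.
apply: inverse_of_bijective.
- by apply: bounded_sub => //; exact: bounded_id.
- by rewrite invr_ge0 ltW.
- move=> y; pose u := fix u n := if n is m.+1 then y + E (u m) else 0 : H.
  pose C := rnorm y / (1 - q).
  have C0 : 0 <= C by rewrite divr_ge0 ?rnorm_ge0 // ltW.
  have CE : rnorm y + q * C = C by rewrite /C; field; rewrite gt_eqF.
  have hC n : rnorm (u n) <= C.
    elim: n => [|n ih] /=; first by rewrite rnorm0.
    apply: le_trans (ler_rnormD _ _) _; rewrite -[leRHS]CE lerD2l.
    by apply: le_trans (hE _) _; rewrite ler_wpM2l.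
  have hd m n : rnorm (u (n + m)%N - u n) <= q ^+ n * C.
    elim: n => [|n ih] /=; first by rewrite subr0 mul1r.
    rewrite opprD addrACA subrr add0r -linop_sub //; apply: le_trans (hE _) _.
    by rewrite exprS -mulrA ler_wpM2l.
  have [l hl] : exists l, forall e : R, 0 < e -> exists N, forall n, (N <= n)%N ->
      rnorm (u n - l) < e.
    apply: rnorm_cauchy => e e0.
    have q01 : 0 <= q < 1 by rewrite q0.
    have [N hN] := expr_lt_eps (2 * C) q01 e0.
    exists N => m n hm hn; rewrite -(subnKC hm) -(subnKC hn).
      have h1 := hd (m - N)%N N; have h2 := hd (n - N)%N N.
      have := hN N (leqnn N).
      have := ler_rnorm_distD (u N) (u (N + (m - N))%N) (u (N + (n - N))%N).
    by rewrite (rnorm_distC (u N)); lra.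
  exists l; rewrite !fctE /=; apply/eqP; rewrite -subr_eq0; apply/eqP.
  apply: rnorm_small_eq0 => e e0.
  have e20 : 0 < e / 2 by rewrite divr_gt0.
  have [N hN] := hl _ e20.
  have h1 := hN N.+1 (leqnSn N); have h2 := hN N (leqnn N).
  have -> : l - E l - y = (E (u N) - E l) - (u N.+1 - l).
    by rewrite opprB [RHS]addrC opprD !addrA subrK addrAC.
  apply: le_trans (ler_rnormB _ _) _; rewrite -linop_sub //.
  have := hE (u N - l); have := rnorm_ge0 (u N - l); nra.
- move=> x; rewrite !fctE /= mulrC ler_pdivlMr //.
  have := ler_rnormB (x - E x) (- E x); rewrite opprK subrK rnormN.
  have := hE x; lra.
Qed.

(** D - E = (1 - E Y) D, and the first factor is inverted by [neumann]. *)
Lemma inverse_perturb D Y E : inverse_ops D Y -> bounded_op E ->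
  opnorm E * opnorm Y < 1 ->
  exists2 Z, inverse_ops (D - E) Z &
    opnorm Z <= opnorm Y / (1 - opnorm E * opnorm Y).
Proof.
move=> iD bE h; have [bD bY h1 h2] := iD.
have [Z iZ nZ] : exists2 Z, inverse_ops (Id - (E \o Y)) Z &
    opnorm Z <= (1 - opnorm E * opnorm Y)^-1.
  apply: neumann; first exact: bounded_comp.
    by rewrite h mulr_ge0 ?opnorm_ge0.
  move=> x /=; apply: le_trans (opnorm_ub _ bE) _.
  by rewrite -mulrA ler_wpM2l ?opnorm_ge0 ?opnorm_ub.
have [bZ1 bZ _ _] := iZ.
exists (Y \o Z).
  have -> : D - E = (Id - (E \o Y)) \o D.
    apply/funext => x; rewrite /= !fctE /=.
    by rewrite -[Y (D x)]/((Y \o D) x) h2.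
  exact: inverse_comp.
by apply: le_trans (opnorm_comp bY bZ) _; rewrite ler_wpM2l ?opnorm_ge0.
Qed.

(** The Lax-Milgram argument: for small e > 0 the operator 1 - e z D is a strict contraction, so e z
    D is invertible by [neumann]. *)
Lemma inverse_coercive D z (d : R) : bounded_op D -> rnorm z = 1 -> 0 < d ->
  (forall x, d * rnorm x ^+ 2 <= complex.Re (z * inner (D x) x)) ->
  exists Y, inverse_ops D Y.
Proof.
move=> bD z1 d0 hd.
set M := opnorm D; have M0 : 0 <= M := opnorm_ge0 D.
have k0 : 0 < M ^+ 2 + d ^+ 2 by rewrite ltr_wpDl ?sqr_ge0 ?exprn_gt0.
(* |x - e z D x|^2 is at most (1 - 2 e d + e^2 M^2) |x|^2, and this choice gives e^2 M^2 <= e d. The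
   summand d^2 keeps the denominator positive when M = 0. *)
pose e := d / (M ^+ 2 + d ^+ 2).
have e0 : 0 < e by rewrite divr_gt0.
have eE : e * (M ^+ 2 + d ^+ 2) = d by rewrite /e divfK // gt_eqF.
have [Y iY _] : exists2 Y, inverse_ops (Id - (Id - (e%:C * z) *: D)) Y &
    opnorm Y <= (1 - Num.sqrt (1 - e * d))^-1.
  have q0 : 0 <= 1 - e * d.
    have : (1 - e * d) * (M ^+ 2 + d ^+ 2) = M ^+ 2.
      by rewrite mulrBl mul1r mulrAC eE; ring.
    have := sqr_ge0 M; nra.
  apply: neumann.
  - by apply: bounded_sub (bounded_id H) _; apply: bounded_scale.
  - rewrite sqrtr_ge0 -[X in _ < X]sqrtr1 ltr_sqrt //= gtrBl mulr_gt0 //.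
  move=> x; rewrite !fctE /=; apply: rnorm_le_sqr.
    by rewrite mulr_ge0 ?sqrtr_ge0 ?rnorm_ge0.
  rewrite exprMn sqr_sqrtr // sqr_rnormB Re_innerC innerZl -mulrA ReZ rnormZ.
  rewrite rnormM z1 rnorm_real mulr1 ger0_norm; last exact: ltW.
  have h1 := hd x; have h2 := opnorm_ub x bD; rewrite -/M in h2.
  have h3 : rnorm (D x) ^+ 2 <= M ^+ 2 * rnorm x ^+ 2.
    by rewrite -exprMn ler_pXn2r ?nnegrE ?mulr_ge0 ?rnorm_ge0.
  have h4 : e ^+ 2 * rnorm (D x) ^+ 2 <= e * d * rnorm x ^+ 2.
    apply: (@le_trans _ _ (e ^+ 2 * (M ^+ 2 * rnorm x ^+ 2))).
      by rewrite ler_wpM2l ?sqr_ge0.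
    rewrite mulrA ler_wpM2r ?sqr_ge0 //.
    have -> : e * d = e ^+ 2 * M ^+ 2 + (e * d) ^+ 2 by rewrite -[X in e * X = _]eE; ring.
    by rewrite lerDl sqr_ge0.
  have h5 : e * (d * rnorm x ^+ 2) <= e * complex.Re (z * inner (D x) x).
    by rewrite ler_wpM2l // ltW.
  rewrite exprMn; lra.
have z0 : e%:C * z != 0.
  rewrite mulf_neq0 //; first by rewrite eq_complex /= gt_eqF.
  by apply/eqP => zE; move: z1; rewrite zE rnorm0 => /esym/eqP; rewrite oner_eq0.
exists ((e%:C * z) *: Y).
have -> : D = (e%:C * z)^-1 *: (Id - (Id - (e%:C * z) *: D)).
  by apply/funext => x; rewrite !fctE /= opprB addrC subrK scalerA mulVf // scale1r.
by rewrite -[X in X *: Y]invrK; apply: inverse_scale; rewrite ?invr_eq0.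
Qed.

(** Jacobson's identity: if Y = (A B - z)^-1, then (B A - z)^-1 = z^-1 (B Y A - 1). *)
Lemma inverse_swap A B z Y : bounded_op A -> bounded_op B -> z != 0 ->
  inverse_ops (A \o B - z *: Id) Y ->
  exists Z, inverse_ops (B \o A - z *: Id) Z.
Proof.
move=> bA bB z0 [_ bY h1 h2].
have lA := bounded_lin bA; have lB := bounded_lin bB; have lY := bounded_lin bY.
have h1' x : A (B (Y x)) = x + z *: Y x.
  by apply/eqP; rewrite -subr_eq; apply/eqP; exact: (congr1 (@^~ x) h1).
have h2' x : Y (A (B x)) = x + z *: Y x.
  apply/eqP; rewrite -subr_eq; apply/eqP; rewrite -linop_scale // -linop_sub //.
  exact: (congr1 (@^~ x) h2).
exists (z^-1 *: (B \o Y \o A - Id)); split.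
- by apply: bounded_sub; [exact: bounded_comp|apply: bounded_scale; exact: bounded_id].
- apply: bounded_scale; apply: bounded_sub; last exact: bounded_id.
  by do 2 apply: bounded_comp => //.
- apply/funext => x; rewrite /= !fctE /=.
  rewrite (linop_scale _ _ lA) (linop_scale _ _ lB) scalerA divff // scale1r.
  rewrite (linop_sub _ _ lA) h1' [A x + _]addrC addrK (linop_scale _ _ lB).
  by rewrite scalerA mulVf // scale1r opprB addrC subrK.
- apply/funext => x; rewrite /= !fctE /=.
  rewrite (linop_sub _ _ lA) (linop_scale _ _ lA) (linop_sub _ _ lY) (linop_scale _ _ lY) h2'.
  by rewrite addrK opprB addrC subrK scalerA mulVf // scale1r.
Qed.

End Invertible.

(** * Orthogonal projection and adjoints *)

Section Riesz.
Variables (R : realType) (H : hilbertType R).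
Implicit Types (S T A B : H -> H) (x y v w : H) (z a : R[i]) (r M e : R).

Lemma conjcM z a : (z * a)^*%C = z^*%C * a^*%C.
Proof. exact: rmorphM. Qed.

Lemma parallelogram x y :
  rnorm (x + y) ^+ 2 + rnorm (x - y) ^+ 2 = 2 * rnorm x ^+ 2 + 2 * rnorm y ^+ 2.
Proof. rewrite sqr_rnormD sqr_rnormB; ring. Qed.

Lemma inner_eq0_of_minimal w v :
  (forall a, rnorm w <= rnorm (w - a *: v)) -> inner w v = 0.
Proof.
move=> h; set a := inner w v.
(* The optimal multiple of <w, v> v has the factor 1 / |v|^2; the summand 1 covers v = 0. *)
pose t : R := (rnorm v ^+ 2 + 1)^-1.
have p0 : 0 < rnorm v ^+ 2 + 1 by rewrite ltr_wpDl ?sqr_ge0.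
have t0 : 0 < t by rewrite invr_gt0.
have tE : t * (rnorm v ^+ 2 + 1) = 1 by rewrite mulVf // gt_eqF.
have := h (t%:C * a); rewrite -(ler_pXn2r (ltn0Sn 1)) ?nnegrE ?rnorm_ge0 //.
rewrite sqr_rnormB innerZr conjcM conjc_real -mulrA ReZ -/a.
rewrite [_^*%C * a]mulrC mulc_conj /= rnormZ rnormM rnorm_real ger0_norm; last exact: ltW.
rewrite !exprMn => h1.
have : t * rnorm a ^+ 2 * (2 - t * rnorm v ^+ 2) <= 0 by lra.
have -> : 2 - t * rnorm v ^+ 2 = 1 + t by lra.
have := sqr_ge0 (rnorm a) => a0 h2.
apply: rnorm_eq0; apply/eqP; rewrite -sqrf_eq0; apply/eqP/le_anti.
rewrite a0 andbT; have : 0 < t * (1 + t) by rewrite mulr_gt0 // addr_gt0.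
by move=> /pmulr_rle0 <-; rewrite mulrAC.
Qed.

Lemma inv_succ_lt e : 0 < e -> exists N, forall n, (N <= n)%N -> n.+1%:R^-1 < e.
Proof.
move=> e0; exists (Num.Def.truncn e^-1) => n hn.
rewrite invf_plt ?posrE ?ltr0Sn //; apply: lt_le_trans (truncnS_gt _) _.
by rewrite ler_nat.
Qed.

(** [V] may fail to be closed, so p is only a limit of its vectors. A minimizing sequence is Cauchy
    by the parallelogram law. *)
Lemma projection_exists (V : set H) x : V 0 ->
  (forall a u v, V u -> V v -> V (a *: u + v)) ->
  exists p, (forall e, 0 < e -> exists2 v, V v & rnorm (p - v) < e) /\
            forall v, V v -> inner (x - p) v = 0.
Proof.
move=> V0 Vlin.
have VZ a v : V v -> V (a *: v) by move=> hv; rewrite -[_ *: _]addr0; apply: Vlin.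
have VD u v : V u -> V v -> V (u + v) by move=> hu hv; rewrite -[u]scale1r; apply: Vlin.
pose D := [set rnorm (x - v) | v in V].
have hD : has_inf D by split; [exists (rnorm (x - 0)), 0|exists 0 => _ [v _ <-]; exact: rnorm_ge0].
set d := inf D.
have dle v : V v -> d <= rnorm (x - v).
  by move=> hv; apply: (ge_inf hD.2); exists v.
have d0 : 0 <= d by apply: lb_le_inf hD.1 _ => _ [v _ <-]; exact: rnorm_ge0.
have /choice [u hu] : forall n : nat, exists v, V v /\ rnorm (x - v) < d + n.+1%:R^-1.
  move=> n; have n0 : 0 < n.+1%:R^-1 :> R by rewrite invr_gt0 ltr0Sn.
  by have [_ [v hv <-] hlt] := inf_adherent n0 hD; exists v.
have gap e : 0 < e -> exists N, forall n, (N <= n)%N -> rnorm (x - u n) < d + e.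
  move=> e0; have [N hN] := inv_succ_lt e0; exists N => n hn.
  by apply: lt_trans (hu n).2 _; rewrite ltrD2l hN.
have [p hp] : exists l, forall e : R, 0 < e -> exists N, forall n, (N <= n)%N ->
      rnorm (u n - l) < e.
  apply: rnorm_cauchy => e e0.
  (* The parallelogram law bounds |u m - u n|^2 by 4 (d + t)^2 - 4 d^2 = t (8 d + 4 t); this t is
     below 1 and satisfies t (8 d + 4) < e^2. *)
  pose t : R := e ^+ 2 / (8 * d + 4 + e ^+ 2).
  have e20 : 0 < e ^+ 2 by rewrite exprn_gt0.
  have q0 : 0 < 8 * d + 4 + e ^+ 2 by lra.
  have t0 : 0 < t by rewrite divr_gt0.
  have tE : t * (8 * d + 4 + e ^+ 2) = e ^+ 2 by rewrite divfK // gt_eqF.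
  have t1 : t < 1 by rewrite ltr_pdivrMr //; lra.
  have [N hN] := gap _ t0; exists N => m n hm hn.
  have hm' := hN m hm; have hn' := hN n hn.
  rewrite -(ltr_pXn2r (ltn0Sn 1)) ?nnegrE ?rnorm_ge0 ?(ltW e0) //.
  have := parallelogram (x - u n) (x - u m).
  have -> : x - u n - (x - u m) = u m - u n.
    by rewrite opprB addrC addrA subrK.
  have -> : x - u n + (x - u m) = 2%:R *: (x - (2%:R^-1 *: (u n + u m))).
    rewrite scalerBr scalerA divff ?pnatr_eq0 // scale1r.
    by rewrite (scaler_nat 2) mulr2n opprD addrACA.
  rewrite rnormZ; have -> : rnorm (2%:R : R[i]) = 2.
    by rewrite -(rmorph_nat (real_complex R)) rnorm_real ger0_norm.
  have hmid : d <= rnorm (x - 2%:R^-1 *: (u n + u m)).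
    by apply: dle; apply: VZ; apply: VD; [case: (hu n)|case: (hu m)].
  move: hmid hm' hn' (rnorm_ge0 (x - u m)) (rnorm_ge0 (x - u n)).
  move: (rnorm (x - u m)) (rnorm (x - u n)) (rnorm (u m - u n)) (rnorm _).
  move=> a b c q hq ha hb a0 b0 hE.
  have qq0 := le_trans d0 hq; have dt0 : 0 <= d + t by lra.
  have : d ^+ 2 <= q ^+ 2 by rewrite ler_pXn2r ?nnegrE.
  have : a ^+ 2 <= (d + t) ^+ 2 by rewrite ler_pXn2r ?nnegrE //; exact: ltW.
  have : b ^+ 2 <= (d + t) ^+ 2 by rewrite ler_pXn2r ?nnegrE //; exact: ltW.
  have : 0 < t * (4 - 4 * t) by rewrite mulr_gt0 // subr_gt0; lra.
  have : 0 < t * e ^+ 2 by rewrite mulr_gt0.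
  rewrite exprMn in hE; lra.
exists p; split.
  move=> e e0; have [N hN] := hp e e0; exists (u N); first by case: (hu N).
  by rewrite rnorm_distC hN.
move=> v hv; apply: inner_eq0_of_minimal => a.
(* As p may lie outside [V], both |x - p| <= d and d <= |x - p - a v| are obtained through the
   approximants [u N]. *)
apply: (@le_trans _ _ d).
  apply/ler_addgt0Pr => e e0; have e20 : 0 < e / 2 by rewrite divr_gt0.
  have [N1 h1] := hp _ e20; have [N2 h2] := gap _ e20.
  have := h1 _ (leq_maxl N1 N2); have := h2 _ (leq_maxr N1 N2).
  have := ler_rnorm_distD (u (maxn N1 N2)) x p; lra.
apply/ler_addgt0Pr => e e0; have [N hN] := hp _ e0.
have := hN _ (leqnn N); have : V (u N + a *: v) by apply: VD; [case: (hu N)|exact: VZ].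
move=> /dle; rewrite opprD addrA.
have := ler_rnormB (x - p - a *: v) (u N - p).
have -> : x - p - a *: v - (u N - p) = x - u N - a *: v.
  by rewrite opprB addrACA subrK [- _ - _]addrC addrA.
lra.
Qed.

(** The representing vector is a multiple of w = x0 - p, where x0 is off the kernel of f and p is
    its projection; boundedness of f puts p into the kernel. *)
Lemma riesz (f : H -> R[i]) M : (forall a u v, f (a *: u + v) = a * f u + f v) ->
  (forall x, rnorm (f x) <= M * rnorm x) -> exists y, forall x, f x = inner x y.
Proof.
move=> lf hM.
have fD u v : f (u + v) = f u + f v by rewrite -[u in LHS]scale1r lf mul1r.
have f0 : f 0 = 0 by apply: (addrI (f 0)); rewrite -fD !addr0.
have fZ a u : f (a *: u) = a * f u by rewrite -[_ *: _]addr0 lf f0 addr0.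
have fB u v : f (u - v) = f u - f v by rewrite fD -scaleN1r fZ mulN1r.
have [[x0 hx0]|h] := pselect (exists x, f x <> 0); last first.
  exists 0 => x; rewrite inner0r; apply: contrapT => hx; apply: h; by exists x.
have kerlin a u v : f u = 0 -> f v = 0 -> f (a *: u + v) = 0.
  by move=> hu hv; rewrite lf hu hv mulr0 addr0.
have [p [happ horth]] := @projection_exists [set x | f x = 0] x0 f0 kerlin.
have fp : f p = 0.
  apply: rnorm_eq0; apply: le_anti; rewrite rnorm_ge0 andbT.
  apply/ler_addgt0Pr => e e0.
  have k0 : 0 < `|M| + 1 by rewrite ltr_wpDl.
  have [v /= fv hv] := happ (e / (`|M| + 1)) (divr_gt0 e0 k0).
  have -> : f p = f (p - v) by rewrite fB fv subr0.
  rewrite add0r; apply: le_trans (hM _) _.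
  have := ler_norm M; have := rnorm_ge0 (p - v).
  by move: hv; rewrite ltr_pdivlMr //; nra.
set w := x0 - p in horth.
have fw : f w != 0 by rewrite fB fp subr0; exact/eqP.
have w0 : rnorm w ^+ 2 != 0.
  rewrite expf_neq0 //; apply: contra fw => /eqP /rnorm_eq0 ->.
  by rewrite f0.
exists (((f w)^*%C / (rnorm w ^+ 2)%:C) *: w) => x.
(* This combination lies in the kernel of f, hence is orthogonal to w; the equation is then solved
   for f x. *)
have : inner w (f w *: x - f x *: w) = 0.
  by apply: horth => /=; rewrite fB !fZ mulrC subrr.
rewrite innerC innerBl !innerZl => /(congr1 (@conjc R)); rewrite conjcK conjc0.
move=> /eqP; rewrite subr_eq0 => /eqP hh.
rewrite innerZr conjcM conjcK conjc_inv conjc_real mulrAC hh inner_sqr mulfK //.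
by rewrite eq_complex /= negb_and w0.
Qed.

(** [adjoint] is a choice; Riesz applied to x |-> <T x, y> shows that there is something to
    choose. *)
Lemma adjoint_spec T : bounded_op T ->
  bounded_op (adjoint T) /\ forall x y, inner (T x) y = inner x (adjoint T y).
Proof.
move=> bT; have lT := bounded_lin bT.
have /choice [S hS] : forall y, exists s, forall x, inner (T x) y = inner x s.
  move=> y; apply: (@riesz (fun x => inner (T x) y) (opnorm T * rnorm y)).
    by move=> a u v; rewrite lT innerDl innerZl.
  move=> x; apply: le_trans (rnorm_inner_le _ _) _.
  by rewrite mulrAC ler_wpM2r ?rnorm_ge0 ?opnorm_ub.
apply: (@xgetPex _ 0 [set S | bounded_op S /\ forall x y, inner (T x) y = inner x (S y)]).
exists S; split=> //; split.
  move=> a u v; apply: inner_ext => x; rewrite innerC -hS innerDr innerZr !hS.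
  by rewrite rmorphD rmorphM /= conjcK -!innerC innerDl innerZl.
exists (opnorm T) => y.
have [s0|s0] := eqVneq (rnorm (S y)) 0.
  by rewrite s0 mulr_ge0 ?opnorm_ge0 ?rnorm_ge0.
have sp : 0 < rnorm (S y) by rewrite lt_def s0 rnorm_ge0.
rewrite -(ler_pM2r sp) -expr2 sqr_rnorm -hS.
apply: le_trans (Re_inner_le _ _) _.
by rewrite mulrAC ler_wpM2r ?rnorm_ge0 ?opnorm_ub.
Qed.

Definition symmetric_op A := forall x y, inner (A x) y = inner x (A y).

Lemma symmetric_Im A x : symmetric_op A -> inner (A x) x = (complex.Re (inner (A x) x))%:C.
Proof.
move=> sA; have := innerC (A x) x; rewrite -sA; case: (inner _ _) => p q [] /=.
by move=> h; congr Complex; lra.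
Qed.

Lemma opnorm_adjoint T : bounded_op T -> opnorm (adjoint T) <= opnorm T.
Proof.
move=> bT; have [bS hS] := adjoint_spec bT.
apply: opnorm_le (opnorm_ge0 _) _ => y.
have [s0|s0] := eqVneq (rnorm (adjoint T y)) 0.
  by rewrite s0 mulr_ge0 ?opnorm_ge0 ?rnorm_ge0.
have sp : 0 < rnorm (adjoint T y) by rewrite lt_def s0 rnorm_ge0.
rewrite -(ler_pM2r sp) -expr2 sqr_rnorm -hS.
apply: le_trans (Re_inner_le _ _) _.
by rewrite mulrAC ler_wpM2r ?rnorm_ge0 ?opnorm_ub.
Qed.

End Riesz.

(** * Polynomials in a symmetric operator *)

Section PolyOp.
Variables (R : realType) (H : hilbertType R).
Implicit Types (S T A B : H -> H) (x y v w : H) (z a : R[i]) (r M e : R) (p q : {poly R[i]}).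

Lemma poly_op_widen n p A x : (size p <= n)%N ->
  poly_op p A x = \sum_(k < n) p`_k *: iter k A x.
Proof.
move=> pn; rewrite /poly_op -!(big_mkord xpredT (fun k => p`_k *: iter k A x)).
rewrite [RHS](big_cat_nat (n := size p)) //= [X in _ + X]big1_seq ?addr0 // => i.
by rewrite mem_index_iota => /andP[_ /andP[h _]]; rewrite nth_default // scale0r.
Qed.

Lemma poly_opD p q A x : poly_op (p + q) A x = poly_op p A x + poly_op q A x.
Proof.
rewrite (@poly_op_widen (maxn (size p) (size q)) (p + q)) ?size_polyD //.
rewrite (@poly_op_widen (maxn (size p) (size q)) p) ?leq_maxl //.
rewrite (@poly_op_widen (maxn (size p) (size q)) q) ?leq_maxr //.
by rewrite -big_split; apply: eq_bigr => i _; rewrite coefD scalerDl.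
Qed.

Lemma poly_opZ a p A x : poly_op (a *: p) A x = a *: poly_op p A x.
Proof.
rewrite (@poly_op_widen (size p)) ?size_scale_leq // scaler_sumr.
by apply: eq_bigr => i _; rewrite coefZ scalerA.
Qed.

Lemma poly_opN p A x : poly_op (- p) A x = - poly_op p A x.
Proof. by rewrite -scaleN1r poly_opZ scaleN1r. Qed.

Lemma poly_opB p q A x : poly_op (p - q) A x = poly_op p A x - poly_op q A x.
Proof. by rewrite poly_opD poly_opN. Qed.

Lemma poly_opC a A x : poly_op a%:P A x = a *: x.
Proof.
by rewrite (@poly_op_widen 1) ?size_polyC_leq1 // big_ord_recl big_ord0 addr0 coefC.
Qed.

Lemma poly_opMX p A x : poly_op (p * 'X) A x = poly_op p A (A x).
Proof.
rewrite (@poly_op_widen (size p).+1) ?size_polyMleq //; last first.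
  by apply: leq_trans (size_polyMleq _ _) _; rewrite size_polyX addn2.
rewrite big_ord_recl coefMX /= scale0r add0r; apply: eq_bigr => i _.
by rewrite coefMX /= -iterSr.
Qed.

Lemma poly_op0 A x : poly_op 0 A x = 0.
Proof. by rewrite poly_opC scale0r. Qed.

Lemma poly_opX A x : poly_op 'X A x = A x.
Proof. by rewrite -[ 'X]mul1r poly_opMX poly_opC scale1r. Qed.

Lemma poly_op_lin p A : linear A -> linear (poly_op p A).
Proof.
move=> lA; have lI k : linear (iter k A).
  by elim: k => [|k ih] a x y //=; rewrite ih lA.
move=> a x y; rewrite /poly_op scaler_sumr -big_split; apply: eq_bigr => i _ /=.
by rewrite lI scalerDr !scalerA mulrC.
Qed.

Lemma poly_op_comm p A x : linear A -> poly_op p A (A x) = A (poly_op p A x).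
Proof.
move=> lA; rewrite /poly_op linop_sum //; apply: eq_bigr => i _.
by rewrite linop_scale // -iterSr.
Qed.

Lemma poly_opM p q A x : linear A -> poly_op (p * q) A x = poly_op p A (poly_op q A x).
Proof.
move=> lA; elim/poly_ind: p q x => [|p c ih] q x.
  by rewrite mul0r !poly_op0.
rewrite mulrDl !poly_opD mul_polyC poly_opZ poly_opC poly_opMX.
by rewrite -mulrA [ 'X * q]mulrC ih poly_opMX poly_op_comm.
Qed.

Lemma bounded_poly_op p A : bounded_op A -> bounded_op (poly_op p A).
Proof.
move=> bA; split; first exact: poly_op_lin (bounded_lin bA).
exists (\sum_(k < size p) rnorm p`_k * opnorm (iter k A)) => x.
apply: le_trans (ler_rnorm_sum _ _) _; rewrite mulr_suml; apply: ler_sum => k _.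
by rewrite rnormZ -mulrA ler_wpM2l ?rnorm_ge0 ?opnorm_ub //; exact: bounded_iter.
Qed.

Lemma poly_op_adj p A x y : linear A -> symmetric_op A ->
  inner (poly_op p A x) y = inner x (poly_op (map_poly (@conjc R) p) A y).
Proof.
move=> lA sA; elim/poly_ind: p x y => [|p c ih] x y.
  by rewrite map_poly0 !poly_op0 inner0l inner0r.
rewrite rmorphD rmorphM /= map_polyX map_polyC /= !poly_opD !poly_opMX !poly_opC.
by rewrite innerDl innerDr innerZl innerZr conjcK ih sA poly_op_comm.
Qed.

End PolyOp.

(** * Spectra of symmetric operators and the norm of p(A) *)

Section Spectrum.
Variables (R : realType) (H : hilbertType R).
Implicit Types (S T A B D E : H -> H) (x y v w : H) (z a u : R[i]) (r M e : R) (p q : {poly R[i]}).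
Local Notation Id := (idfun : H -> H).

Lemma bounded_shift T z : bounded_op T -> bounded_op (T - z *: Id).
Proof. by move=> bT; apply: bounded_sub => //; apply: bounded_scale; exact: bounded_id. Qed.

(** The source of the bounds on spectral values below. If e > 0, then u describes a half-plane that
    contains the numerical range of T and stays at distance e from z, and T - z is coercive. *)
Lemma spectrum_not_coercive T z u e : bounded_op T -> spectrum T z -> rnorm u = 1 ->
  (forall x, e * rnorm x ^+ 2 <= complex.Re (u * (inner (T x) x - z * (rnorm x ^+ 2)%:C))) ->
  e <= 0.
Proof.
move=> bT sz u1 h; rewrite leNgt; apply/negP => e0; apply: sz.
apply: inverse_coercive (bounded_shift z bT) u1 e0 _ => x.
apply: le_trans (h x) _; rewrite !fctE /= innerBl innerZl inner_sqr.
exact: lexx.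
Qed.

Lemma spectrum_le_opnorm T z : bounded_op T -> spectrum T z -> rnorm z <= opnorm T.
Proof.
move=> bT sz; have [->|z0] := eqVneq z 0; first by rewrite rnorm0 opnorm_ge0.
have zp : 0 < rnorm z.
  by rewrite lt_def rnorm_ge0 andbT; apply: contra z0 => /eqP /rnorm_eq0 ->.
rewrite -subr_le0.
(* This u turns z into -|z|, which allows e = |z| - |T|. *)
apply: (@spectrum_not_coercive T z (- (z^*%C / (rnorm z)%:C)) _ bT sz).
  rewrite rnormN rnormM rnormV rnormc_conj rnorm_real ger0_norm ?rnorm_ge0 //.
  by rewrite divff // gt_eqF.
move=> x; rewrite mulNr mulrBr opprB ReD ReN.
have -> : z^*%C / (rnorm z)%:C * (z * (rnorm x ^+ 2)%:C) = (rnorm z * rnorm x ^+ 2)%:C.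
  have -> : z^*%C / (rnorm z)%:C * (z * (rnorm x ^+ 2)%:C) =
     (z * z^*%C) / (rnorm z)%:C * (rnorm x ^+ 2)%:C by ring.
  rewrite mulc_conj -fmorphV -!rmorphM /=; congr (_%:C); congr (_ * _).
  by rewrite expr2 mulfK // gt_eqF.
rewrite /= mulrBl lerD2l lerN2.
apply: le_trans (Re_le_rnorm _) _.
rewrite !rnormM rnormV rnormc_conj rnorm_real ger0_norm ?rnorm_ge0 //.
rewrite divff ?gt_eqF // mul1r; apply: le_trans (rnorm_inner_le _ _) _.
by rewrite expr2 mulrA ler_wpM2r ?rnorm_ge0 ?opnorm_ub.
Qed.

Lemma spectrum_symmetric_real A z : bounded_op A -> symmetric_op A -> spectrum A z ->
  z = (complex.Re z)%:C.
Proof.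
move=> bA sA; case: z => [a b] sz /=.
have ni : rnorm (0 +i* 1 : R[i]) = 1.
  by apply/eqP; rewrite -(@eqrXn2 _ 2) ?rnorm_ge0 // sqr_rnormc /= expr0n /= add0r.
have h1 : b <= 0.
  apply: (@spectrum_not_coercive A _ (0 +i* 1) b bA sz ni) => x.
  by rewrite (symmetric_Im _ sA) /=; lra.
have h2 : - b <= 0.
  apply: (@spectrum_not_coercive A _ (- (0 +i* 1)) (- b) bA sz); first by rewrite rnormN.
  by move=> x; rewrite (symmetric_Im _ sA) /=; lra.
by congr Complex; lra.
Qed.

Lemma spectrum_positive A z : bounded_op A -> symmetric_op A ->
  (forall x, 0 <= complex.Re (inner (A x) x)) -> spectrum A z -> 0 <= complex.Re z.
Proof.
move=> bA sA pA sz; rewrite -oppr_le0.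
apply: (@spectrum_not_coercive A z 1 _ bA sz (rnorm1 R)) => x.
rewrite (spectrum_symmetric_real bA sA sz) mul1r ReD ReN ReZ /=.
by have := pA x; lra.
Qed.

(** One half of the spectral mapping theorem: over the complex numbers p splits into linear factors,
    each of which gives an invertible operator. *)
Lemma poly_op_inverse p A : bounded_op A -> p != 0 ->
  (forall z, root p z -> ~ spectrum A z) -> exists Y, inverse_ops (poly_op p A) Y.
Proof.
move=> bA p0 hp; have [r pE] := closed_field_poly_normal p.
have lp0 : lead_coef p != 0 by rewrite lead_coef_eq0.
have hr z : z \in r -> ~ spectrum A z.
  by move=> zr; apply: hp; rewrite pE rootZ // root_prod_XsubC.
have [Y iY] : exists Y, inverse_ops (poly_op (\prod_(z <- r) ('X - z%:P)) A) Y.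
  elim: r {pE} hr => [|z r ih] hr.
    exists Id; rewrite big_nil.
    have -> : poly_op 1 A = Id by apply/funext => x; rewrite poly_opC scale1r.
    by split=> //; exact: bounded_id.
  have [Y iY] : exists Y, inverse_ops (poly_op (\prod_(z <- r) ('X - z%:P)) A) Y.
    by apply: ih => a ar; apply: hr; rewrite inE ar orbT.
  have [Z iZ] : exists Z, inverse_ops (A - z *: Id) Z.
    by apply: contrapT; apply: hr; rewrite inE eqxx.
  exists (Y \o Z); rewrite big_cons.
  have -> : poly_op (('X - z%:P) * \prod_(j <- r) ('X - j%:P)) A =
      (A - z *: Id) \o poly_op (\prod_(z <- r) ('X - z%:P)) A.
    apply/funext => x; rewrite poly_opM; last exact: bounded_lin.
    by rewrite poly_opB poly_opX poly_opC.
  exact: inverse_comp.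
exists ((lead_coef p)^-1 *: Y); rewrite [X in poly_op X]pE.
have -> : poly_op (lead_coef p *: \prod_(z <- r) ('X - z%:P)) A =
   lead_coef p *: poly_op (\prod_(z <- r) ('X - z%:P)) A.
  by apply/funext => x; rewrite poly_opZ.
exact: inverse_scale.
Qed.

Hypothesis H_neq0 : exists x : H, x != 0.

Lemma zero_not_invertible T Y : (forall x, T x = 0) -> ~ inverse_ops T Y.
Proof.
move=> T0 [bT bY h1 h2]; have [x /eqP x0] := H_neq0; apply: x0.
have := congr1 (@^~ x) h2; rewrite /= T0 => <-.
exact: linop0 (bounded_lin bY).
Qed.

(** If neither m nor -m were spectral, D = A^2 - m^2 would be bounded below. By symmetry |D x|^2 <=
    m^4 |x|^2 - m^2 |A x|^2, so A would have a bound strictly below m = |A|. *)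
Lemma opnorm_in_spectrum A : bounded_op A -> symmetric_op A ->
  exists2 s, `|s| = opnorm A & spectrum A s%:C.
Proof.
move=> bA sA; set m := opnorm A; have lA := bounded_lin bA.
have m0 : 0 <= m := opnorm_ge0 A.
apply: contrapT => h.
have [Y iY] : exists Y, inverse_ops (A - m%:C *: Id) Y.
  by apply: contrapT => h1; apply: h; exists m; rewrite ?ger0_norm.
have [Z iZ] : exists Z, inverse_ops (A - (- m)%:C *: Id) Z.
  by apply: contrapT => h1; apply: h; exists (- m); rewrite ?normrN ?ger0_norm.
have iC := inverse_comp iY iZ.
set D := _ \o _ in iC; set W := _ \o _ in iC.
have DE x : D x = A (A x) - (m ^+ 2)%:C *: x.
  rewrite /D /= !fctE /= rmorphN scaleNr opprK (linop_add _ _ lA) (linop_scale _ _ lA) scalerDr scalerA.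
  by rewrite -rmorphM -expr2 opprD addrA addrK.
have nrm x : rnorm (D x) ^+ 2 <= m ^+ 4 * rnorm x ^+ 2 - m ^+ 2 * rnorm (A x) ^+ 2.
  rewrite DE sqr_rnormB innerZr conjc_real ReZ sA -sqr_rnorm rnormZ rnorm_real.
  rewrite ger0_norm ?sqr_ge0 //.
  have h1 : rnorm (A (A x)) ^+ 2 <= m ^+ 2 * rnorm (A x) ^+ 2.
    rewrite -exprMn ler_pXn2r ?nnegrE ?mulr_ge0 ?rnorm_ge0 //; exact: opnorm_ub.
  rewrite exprMn -exprM; lra.
set K := opnorm W; have K0 : 0 <= K := opnorm_ge0 W.
have low x : rnorm x <= K * rnorm (D x) by apply: inverse_bounded_below iC.
(* For m = 0 the operator D vanishes, and 0 is not invertible on a nonzero space. *)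
have [m_eq0|m_neq0] := eqVneq m 0.
  have A0 x : A x = 0.
    apply: rnorm_eq0; apply: le_anti; rewrite rnorm_ge0 andbT.
    by have := opnorm_ub x bA; rewrite -/m m_eq0 mul0r.
  apply: (zero_not_invertible _ iC) => x.
  by rewrite DE m_eq0 expr0n /= A0 scale0r subr0.
have mp : 0 < m by rewrite lt_def m_neq0.
have [x0 x0n] := H_neq0.
have Kp : 0 < K.
  rewrite lt_def K0 andbT; apply: contra x0n => /eqP KE; apply/eqP/rnorm_eq0/le_anti.
  by rewrite rnorm_ge0 andbT (le_trans (low x0)) // KE mul0r.
pose k := K ^- 2; have k0 : 0 < k by rewrite invr_gt0 exprn_gt0.
have low2 x : k * rnorm x ^+ 2 <= rnorm (D x) ^+ 2.
  rewrite /k mulrC ler_pdivrMr ?exprn_gt0 // [leRHS]mulrC -exprMn.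
  by rewrite ler_pXn2r ?nnegrE ?mulr_ge0 ?rnorm_ge0.
have hA x : m ^+ 2 * rnorm (A x) ^+ 2 <= (m ^+ 4 - k) * rnorm x ^+ 2.
  by have := low2 x; have := nrm x; lra.
have q0 : 0 <= m ^+ 4 - k.
  have x0p : 0 < rnorm x0 ^+ 2.
    by rewrite exprn_gt0 // lt_def rnorm_ge0 andbT; apply: contra x0n => /eqP /rnorm_eq0 ->.
  rewrite -(pmulr_lge0 _ x0p); apply: le_trans (hA x0).
  by rewrite mulr_ge0 ?sqr_ge0.
suff : m <= Num.sqrt (m ^+ 4 - k) / m.
  rewrite ler_pdivlMr // -expr2 -(ler_pXn2r (ltn0Sn 1)) ?nnegrE ?sqr_ge0 ?sqrtr_ge0 //.
  rewrite sqr_sqrtr // -exprM; lra.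
apply: opnorm_le => [|x]; first by rewrite divr_ge0 ?sqrtr_ge0.
rewrite mulrAC ler_pdivlMr //; apply: le_trans (_ : `|rnorm (A x) * m| <= _); first exact: ler_norm.
rewrite -sqrtr_sqr -[X in _ <= _ * X]ger0_norm ?rnorm_ge0 // -sqrtr_sqr -sqrtrM //.
by rewrite ler_wsqrtr // exprMn mulrC.
Qed.

Lemma map_conj_real p r : (map_poly (@conjc R) p).[r%:C] = (p.[r%:C])^*%C.
Proof. by rewrite -[in LHS](conjc_real r) horner_map. Qed.

(* For symmetric A the operator p(A)^* p(A) is a polynomial in A whose norm is
   attained in its spectrum, which is contained in |p|^2(spectrum A). *)
Lemma poly_op_norm_le p A M : bounded_op A -> symmetric_op A -> 0 <= M ->
  (forall z, spectrum A z -> rnorm p.[z] <= M) -> opnorm (poly_op p A) <= M.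
Proof.
move=> bA sA M0 hM; have lA := bounded_lin bA.
pose q := map_poly (@conjc R) p * p.
have bB : bounded_op (poly_op q A) by exact: bounded_poly_op.
have conjq : map_poly (@conjc R) q = q.
  rewrite /q rmorphM /= mulrC; congr (_ * _).
  by rewrite -map_poly_comp map_poly_id // => z _; rewrite /= conjcK.
have sB : symmetric_op (poly_op q A) by move=> x y; rewrite poly_op_adj // conjq.
have [s sE sp] := opnorm_in_spectrum bB sB.
have [z sz qz] : exists2 z, spectrum A z & q.[z] = s%:C.
  (* If q is the constant s, there is no nonzero polynomial to factor; any spectral value of A
     serves, and [opnorm_in_spectrum] provides one. *)
  have [q0|q0] := eqVneq (q - s%:C%:P) 0.
    have [t _ st] := opnorm_in_spectrum bA sA; exists t%:C => //.
    have := congr1 (fun p => p.[t%:C]) q0; rewrite !hornerE => /eqP.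
    by rewrite subr_eq0 => /eqP.
  apply: contrapT => h; apply: sp.
  have [Y iY] : exists Y, inverse_ops (poly_op (q - s%:C%:P) A) Y.
    apply: poly_op_inverse => // z; rewrite /root !hornerE subr_eq0 => /eqP hz sz.
    by apply: h; exists z; rewrite ?hornerM.
  exists Y; have -> // : poly_op q A - s%:C *: Id = poly_op (q - s%:C%:P) A.
  by apply/funext => x; rewrite poly_opB poly_opC.
have sM : `|s| <= M ^+ 2.
  have zE := spectrum_symmetric_real bA sA sz.
  rewrite -rnorm_real -qz hornerM zE map_conj_real rnormM rnormc_conj -zE -expr2.
  by rewrite ler_pXn2r ?nnegrE ?rnorm_ge0 //; exact: hM.
apply: opnorm_le => // x; apply: rnorm_le_sqr; first by rewrite mulr_ge0 ?rnorm_ge0.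
rewrite sqr_rnorm poly_op_adj // -poly_opM // -/q.
apply: le_trans (Re_inner_le _ _) _; rewrite exprMn [X in _ <= _ * X]expr2 mulrA mulrC.
rewrite ler_wpM2r ?rnorm_ge0 //; apply: le_trans (opnorm_ub _ bB) _.
by rewrite ler_wpM2r ?rnorm_ge0 // -sE.
Qed.

End Spectrum.

(** * Polynomial approximation of powers *)

Section Weierstrass.
Variable R : realType.
Implicit Types (g h f : nat -> R) (x c e s t M : R).

(* The binomial average of g with n trials, defined by conditioning on the first
   trial instead of through binomial coefficients. *)
Fixpoint bernstein n g : {poly R} :=
  if n is m.+1 then (1 - 'X) * bernstein m g + 'X * bernstein m (g \o succn)
  else (g 0%N)%:P.

Lemma bernstein_horner n g x : (bernstein n.+1 g).[x] =
  (1 - x) * (bernstein n g).[x] + x * (bernstein n (g \o succn)).[x].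
Proof. by rewrite /= !hornerE. Qed.

Lemma bernstein_le n g h x : 0 <= x <= 1 -> (forall k, g k <= h k) ->
  (bernstein n g).[x] <= (bernstein n h).[x].
Proof.
move=> /andP[x0 x1]; elim: n g h => [|n ih] g h gh; first by rewrite !hornerC.
rewrite !bernstein_horner; apply: lerD; apply: ler_wpM2l; rewrite ?subr_ge0 //.
  exact: ih.
by apply: ih => k; exact: gh.
Qed.

Lemma bernstein_affine n a b g x :
  (bernstein n (fun k => a + b * g k)).[x] = a + b * (bernstein n g).[x].
Proof.
elim: n g => [|n ih] g; first by rewrite !hornerC.
rewrite !bernstein_horner ih.
rewrite -[(fun k => _) \o succn]/(fun k => a + b * (g \o succn) k) ih; ring.
Qed.

(** A general c makes the induction work, since shifting k by one shifts c by one. For c = n x this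
    is the binomial variance. *)
Lemma bernstein_variance n c x :
  (bernstein n (fun k => (k%:R - c) ^+ 2)).[x] =
    n%:R * (x * (1 - x)) + (n%:R * x - c) ^+ 2.
Proof.
elim: n c => [|n ih] c; first by rewrite hornerC !mul0r !add0r.
rewrite bernstein_horner ih.
have -> : (fun k => (k%:R - c) ^+ 2) \o succn = (fun k => (k%:R - (c - 1)) ^+ 2).
  by apply/funext => k /=; congr (_ ^+ 2); rewrite -natr1; ring.
rewrite ih -natr1; ring.
Qed.

(** Subadditivity of the power: u / (a + b) <= (u / (a + b))^s for u = a and u = b, and the left
    sides add up to 1. *)
Lemma powR_dist_le s x t : 0 < s <= 1 -> 0 <= x -> 0 <= t ->
  `|x `^ s - t `^ s| <= `|x - t| `^ s.
Proof.
move=> /andP[s0 s1].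
have sub (a b : R) : 0 <= a -> 0 <= b -> (a + b) `^ s <= a `^ s + b `^ s.
  move=> a0 b0; have [ab|ab] := eqVneq (a + b) 0.
    by rewrite ab powR0 ?gt_eqF // addr_ge0 ?powR_ge0.
  have abp : 0 < a + b by rewrite lt_def ab addr_ge0.
  have key (u : R) : 0 <= u <= a + b -> u / (a + b) * (a + b) `^ s <= u `^ s.
    move=> /andP[u0 uab]; have [->|un] := eqVneq u 0; first by rewrite !mul0r powR_ge0.
    have ab0 := ltW abp.
    rewrite -[X in _ <= X `^ _](divfK ab) powRM ?divr_ge0 //.
    rewrite ler_wpM2r ?powR_ge0 // ger1_powR //.
    have up : 0 < u by rewrite lt_def un.
    by rewrite divr_gt0 //= ler_pdivrMr // mul1r.
  have h1 := key a; have h2 := key b.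
  apply: (@le_trans _ _ (a / (a + b) * (a + b) `^ s + b / (a + b) * (a + b) `^ s)).
    by rewrite -mulrDl -mulrDl divff // mul1r.
  by apply: lerD; [apply: h1|apply: h2]; rewrite ?a0 ?b0 ?lerDl ?lerDr.
have gen (a b : R) : 0 <= b -> b <= a -> `|a `^ s - b `^ s| <= `|a - b| `^ s.
  move=> b0 ba; have a0 := le_trans b0 ba.
  rewrite !ger0_norm ?subr_ge0 //; last by rewrite ge0_ler_powR // ?nnegrE // ltW.
  by rewrite lerBlDl; apply: le_trans (sub _ _ b0 _); rewrite ?subr_ge0 // addrC subrK.
move=> x0 t0; have [xt|tx] := leP x t; last exact/gen/ltW.
by rewrite distrC (distrC x); exact: gen.
Qed.

(** A quadratic majorant of the modulus of continuity is what [bernstein_variance] can average. *)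
Lemma powR_modulus s e : 0 <= s <= 1 -> 0 < e -> exists2 C, 0 <= C &
  forall x t, 0 <= x -> 0 <= t -> `|x `^ s - t `^ s| <= e + C * (x - t) ^+ 2.
Proof.
move=> /andP[s0 s1] e0; have [->|sn] := eqVneq s 0.
  by exists 0 => // x t _ _; rewrite !powRr0 subrr normr0 mul0r addr0 ltW.
have sp : 0 < s by rewrite lt_def sn.
(* Let u = |x - t|. If u <= d, then u^s <= e. If u > d, then u^s <= u + 1 <= u^2 / d + u^2 / d^2. *)
pose d := e `^ s^-1; have d0 : 0 < d by rewrite powR_gt0.
have ds : d `^ s = e by rewrite -powRrM mulVf // powRr1 // ltW.
exists (d^-1 + d ^- 2); first by rewrite addr_ge0 ?invr_ge0 ?exprn_ge0 // ltW.
move=> x t x0 t0; apply: le_trans (powR_dist_le _ x0 t0) _; first by rewrite sp.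
rewrite -(real_normK (num_real (x - t))); set u := `|_|; have u0 : 0 <= u := normr_ge0 _.
have [ud|du] := leP u d.
  apply: (@le_trans _ _ e).
    by rewrite -ds ge0_ler_powR // ?nnegrE // ltW.
  by rewrite lerDl mulr_ge0 ?sqr_ge0 // addr_ge0 ?invr_ge0 ?exprn_ge0 // ltW.
apply: (@le_trans _ _ (u + 1)).
  have [u1|u1] := leP 1 u.
    by apply: (@le_trans _ _ u); [exact: ler1_powR|rewrite lerDl].
  apply: (@le_trans _ _ 1); last by rewrite lerDr.
  have E1 : (1 : R) `^ s = 1 by rewrite powR1.
  by rewrite -E1 ge0_ler_powR // ?nnegrE // ltW.
apply: (@le_trans _ _ ((d^-1 + d ^- 2) * u ^+ 2)); last by rewrite lerDr ltW.
rewrite mulrDl; apply: lerD.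
  by rewrite mulrC ler_pdivlMr // expr2 ler_wpM2l // ltW.
by rewrite mulrC ler_pdivlMr ?exprn_gt0 // mul1r ler_pXn2r ?nnegrE // ltW.
Qed.

Lemma powR_polynomial_approx s M e : 0 <= s <= 1 -> 0 < M -> 0 < e ->
  exists p : {poly R}, forall t, 0 <= t <= M -> `|p.[t] - t `^ s| <= e.
Proof.
move=> s01 M0 e0; have e20 : 0 < e / 2 by rewrite divr_gt0.
have [C C0 hC] := powR_modulus s01 e20.
have CM0 : 0 <= C * M ^+ 2 by rewrite mulr_ge0 ?sqr_ge0.
(* Bernstein's argument on [0, M] rescaled to [0, 1]: the average of the quadratic term is C M^2 x
   (1 - x) / n, to be kept below e / 2. *)
have [n n0 hn] : exists2 n : nat, 0 < n%:R :> R & C * M ^+ 2 / n%:R <= e / 2.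
  exists (Num.Def.truncn (C * M ^+ 2 / (e / 2))).+1; first exact: ltr0Sn.
  rewrite ler_pdivrMr // [leRHS]mulrC -ler_pdivrMr //; apply: ltW; exact: truncnS_gt.
exists (bernstein n (fun k => (M * (k%:R / n%:R)) `^ s) \Po (M^-1 *: 'X)) => t /andP[t0 tM].
rewrite horner_comp !hornerE; set x := M^-1 * t.
have tE : t = M * x by rewrite /x mulrA divff ?mul1r // gt_eqF.
have x0 : 0 <= x by rewrite mulr_ge0 // invr_ge0 ltW.
have x1 : x <= 1 by rewrite /x mulrC ler_pdivrMr // mul1r.
have x01 : 0 <= x <= 1 by rewrite x0.
have key k : `|(M * (k%:R / n%:R)) `^ s - t `^ s| <=
    e / 2 + (C * M ^+ 2 / n%:R ^+ 2) * (k%:R - n%:R * x) ^+ 2.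
  have Mk0 : 0 <= M * (k%:R / n%:R) by rewrite mulr_ge0 ?divr_ge0 //; exact: ltW.
  have := hC _ _ Mk0 t0.
  have -> // : C * (M * (k%:R / n%:R) - t) ^+ 2 =
     C * M ^+ 2 / n%:R ^+ 2 * (k%:R - n%:R * x) ^+ 2.
  by rewrite tE; field; rewrite gt_eqF.
have fin : e / 2 + C * M ^+ 2 / n%:R ^+ 2 * (n%:R * (x * (1 - x)) + (n%:R * x - n%:R * x) ^+ 2) <= e.
  rewrite subrr expr0n /= addr0.
  have -> : C * M ^+ 2 / n%:R ^+ 2 * (n%:R * (x * (1 - x))) = C * M ^+ 2 / n%:R * (x * (1 - x)).
    by field; rewrite gt_eqF.
  have q0 : 0 <= C * M ^+ 2 / n%:R by rewrite divr_ge0 // ltW.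
  have : x * (1 - x) <= 1 by nra.
  have : 0 <= x * (1 - x) by rewrite mulr_ge0 // subr_ge0.
  nra.
rewrite ler_norml; apply/andP; split.
  have := @bernstein_le n (fun k => (t `^ s - e / 2) + (- (C * M ^+ 2 / n%:R ^+ 2)) * (k%:R - n%:R * x) ^+ 2)
      (fun k => (M * (k%:R / n%:R)) `^ s) x x01.
  rewrite bernstein_affine bernstein_variance.
  have h k : t `^ s - e / 2 + - (C * M ^+ 2 / n%:R ^+ 2) * (k%:R - n%:R * x) ^+ 2 <= (M * (k%:R / n%:R)) `^ s.
    by have := key k; rewrite ler_norml => /andP[]; lra.
  move=> /(_ h); rewrite mulNr; move: fin; set V := C * M ^+ 2 / _ * _; lra.
have := @bernstein_le n (fun k => (M * (k%:R / n%:R)) `^ s)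
   (fun k => (t `^ s + e / 2) + (C * M ^+ 2 / n%:R ^+ 2) * (k%:R - n%:R * x) ^+ 2) x x01.
rewrite bernstein_affine bernstein_variance.
have h k : (M * (k%:R / n%:R)) `^ s <= t `^ s + e / 2 + (C * M ^+ 2 / n%:R ^+ 2) * (k%:R - n%:R * x) ^+ 2.
  by have := key k; rewrite ler_norml => /andP[]; lra.
move=> /(_ h); move: fin; set V := C * M ^+ 2 / _ * _; lra.
Qed.

End Weierstrass.

(** * Powers of positive operators *)

(** At r = 0 the exponents cannot both vanish, so one factor is 0 although the other may be 0^0 =
    1. *)
Lemma powR_split (R : realType) (r s t : R) : 0 <= r -> s + t = 1 ->
  r `^ s * r `^ t = r.
Proof.
move=> r0 st; have [->|rn] := eqVneq r 0.
  have [s0|sn] := eqVneq s 0; last by rewrite powR0 ?mul0r.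
  by rewrite [X in _ * X]powR0 ?mulr0 //; apply/eqP; lra.
by rewrite -powRD ?rn ?implybT // st powRr1.
Qed.

Section OpPow.
Variables (R : realType) (H : hilbertType R).
Implicit Types (S T A B D E : H -> H) (x y v w : H) (z a u : R[i]) (r M e s t : R).
Implicit Types (p q : {poly R[i]}).

(** The limit is taken pointwise; letting one index of the Cauchy condition tend to infinity at each
    x gives a bound that is uniform in x. *)
Lemma opnorm_cauchy (Q : nat -> H -> H) : (forall k, bounded_op (Q k)) ->
  (forall e, 0 < e -> exists N, forall m n, (N <= m)%N -> (N <= n)%N ->
     opnorm (Q m - Q n) <= e) ->
  exists2 B, bounded_op B & forall e, 0 < e -> exists N, forall n, (N <= n)%N ->
     opnorm (Q n - B) <= e.
Proof.
move=> bQ cQ.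
have /choice [B hB] : forall x, exists l, forall e, 0 < e -> exists N, forall n, (N <= n)%N ->
    rnorm (Q n x - l) < e.
  move=> x; apply: rnorm_cauchy => e e0.
  have k0 : 0 < rnorm x + 1 by rewrite ltr_wpDl ?rnorm_ge0.
  have [N hN] := cQ (e / 2 / (rnorm x + 1)) (divr_gt0 (divr_gt0 e0 (ltr0Sn _ 1)) k0).
  exists N => m n hm hn; have := opnorm_ub x (bounded_sub (bQ m) (bQ n)).
  have := hN m n hm hn; rewrite ler_pdivlMr //= !fctE.
  have := opnorm_ge0 (Q m - Q n); have := rnorm_ge0 x; nra.
have dist e : 0 < e -> exists N, forall n, (N <= n)%N -> forall x,
    rnorm (Q n x - B x) <= e * rnorm x.
  move=> e0; have [N hN] := cQ e e0; exists N => n hn x.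
  apply/ler_addgt0Pr => d d0; have [N2 hN2] := hB x d d0.
  have := hN2 _ (leq_maxr N N2).
  have := opnorm_ub x (bounded_sub (bQ n) (bQ (maxn N N2))).
  have := ler_rnorm_distD (Q (maxn N N2) x) (Q n x) (B x); rewrite !fctE.
  have : opnorm (Q n - Q (maxn N N2)) * rnorm x <= e * rnorm x.
    by rewrite ler_wpM2r ?rnorm_ge0 // hN // leq_maxl.
  lra.
have lB : linear B.
  move=> a x y; apply/eqP; rewrite -subr_eq0; apply/eqP/rnorm_small_eq0 => e e0.
  pose k : R := rnorm (a *: x + y) + rnorm a * rnorm x + rnorm y + 1.
  have k0 : 0 < k by rewrite ltr_wpDl // !addr_ge0 ?mulr_ge0 ?rnorm_ge0.
  have [N hN] := dist (e / k) (divr_gt0 e0 k0).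
  have -> : B (a *: x + y) - (a *: B x + B y) =
     (a *: (Q N x - B x) + (Q N y - B y)) - (Q N (a *: x + y) - B (a *: x + y)).
    rewrite (bounded_lin (bQ N)) scalerBr (addrACA (a *: Q N x)) -opprD opprB.
    by rewrite [RHS]addrC addrA subrK.
  apply: le_trans (ler_rnormB _ _) _.
  have h1 := hN N (leqnn N) x; have h2 := hN N (leqnn N) y.
  have h3 := hN N (leqnn N) (a *: x + y).
  have h4 := ler_rnormD (a *: (Q N x - B x)) (Q N y - B y).
  have h5 := rnormZ a (Q N x - B x).
  have h6 : rnorm a * rnorm (Q N x - B x) <= rnorm a * (e / k * rnorm x).
    by rewrite ler_wpM2l ?rnorm_ge0.
  have -> : e = e / k * k by rewrite divfK // gt_eqF.
  have : 0 < e / k by rewrite divr_gt0.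
  move: h1 h2 h3 h6; set d := e / k => h1 h2 h3 h6 d0; rewrite /k; lra.
exists B.
  split=> //; have [N hN] := dist 1 ltr01; exists (opnorm (Q N) + 1) => x.
  have := hN N (leqnn N) x; have := opnorm_ub x (bQ N).
  have := ler_rnorm_distD 0 (B x) (Q N x); have := ler_rnormB (Q N x) (Q N x - B x).
  by rewrite opprB addrC subrK; lra.
move=> e e0; have [N hN] := dist e e0; exists N => n hn.
by apply: opnorm_le; [exact: ltW|move=> x; rewrite !fctE; exact: hN].
Qed.

(** [op_pow] is defined by the uniform topology of the library, with entourages of R[i]; the
    estimates below use real bounds. *)
Lemma cvg_uniformP (S : set R[i]) (F : nat -> R[i] -> R[i]) (f : R[i] -> R[i]) :
  {uniform S, (fun k z => F k z : R[i]^o) @ \oo --> (fun z => f z : R[i]^o)} <->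
  forall e, 0 < e -> exists N, forall n, (N <= n)%N -> forall z, S z -> rnorm (F n z - f z) <= e.
Proof.
split.
  move=> h e e0.
  have ec : 0 < e%:C :> R[i] by rewrite ltcR.
  have : nbhs (f : {uniform` S -> R[i]^o})
      [set g : {uniform` S -> R[i]^o} | forall z, S z -> rnorm (g z - f z) <= e].
    apply/uniform_nbhs; exists [set xy | ball xy.1 e%:C xy.2]; split.
      exact: entourage_ball (PosNum ec).
    move=> g hg z Sz; have := hg z Sz; rewrite /= -ball_normE /= rnormE ltcR rnorm_distC.
    exact: ltW.
  by move=> /h [N _ hN]; exists N => n hn; exact: hN.
move=> h P /uniform_nbhs [E [entE EP]].
have [e e0 he] : exists2 e : R[i], 0 < e & forall x y : R[i]^o, ball x e y -> E (x, y).
  move: entE; rewrite -entourage_ballE => -[e e0 he]; exists e => // x y bxy.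
  exact: (he (x, y)).
have e1 : 0 < complex.Re e by move: e0; rewrite ltcE => /andP[].
have eE : e = (complex.Re e)%:C by rewrite RRe_real // gtr0_real.
have [N hN] := h (complex.Re e / 2) (divr_gt0 e1 (ltr0Sn _ 1)).
exists N => // n /= hn; apply: EP => z Sz; apply: he.
rewrite -ball_normE /= rnormE eE ltcR rnorm_distC.
by have := hN n hn z Sz; move: e1; lra.
Qed.

Hypothesis H_neq0 : exists x : H, x != 0.

Definition positive_op A := [/\ bounded_op A, symmetric_op A &
  forall x, 0 <= complex.Re (inner (A x) x)].

Variable A : H -> H.
Hypothesis pA : positive_op A.

Let bA : bounded_op A. Proof. by case: pA. Qed.
Let sA : symmetric_op A. Proof. by case: pA. Qed.
Let lA : linear A := bounded_lin bA.

Definition cpow s z : R[i] := (complex.Re z `^ s)%:C.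

Lemma spectrum_positiveP z : spectrum A z ->
  exists2 t, 0 <= t <= opnorm A & z = t%:C.
Proof.
move=> sz; have [_ _ pA'] := pA.
have zE := spectrum_symmetric_real bA sA sz.
exists (complex.Re z) => //; rewrite (spectrum_positive bA sA pA' sz) /=.
exact: le_trans (Re_le_rnorm _) (spectrum_le_opnorm bA sz).
Qed.

(* The approximations are squares of real polynomials, which makes the limit
   a positive operator. *)
Lemma cpow_approx s e : 0 <= s <= 1 -> 0 < e -> exists r : {poly R},
  forall z, spectrum A z -> rnorm ((map_poly (real_complex R) (r ^+ 2)).[z] - cpow s z) <= e.
Proof.
move=> /andP[s0 s1] e0; pose M := opnorm A + 1.
have M0 : 0 < M by rewrite ltr_wpDl ?opnorm_ge0.
pose L := M `^ (s / 2); have L0 : 0 <= L := powR_ge0 _ _.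
(* The difference r^2 - t^s factors into r - t^(s/2), at most d in modulus, and r + t^(s/2), at most
   2 L + 1 because d <= 1. *)
pose d := Num.min 1 (e / (2 * L + 1)).
have q0 : 0 < 2 * L + 1 by lra.
have d0 : 0 < d by rewrite lt_min ltr01 divr_gt0.
have d1 : d <= 1 by rewrite ge_min lexx.
have de : d * (2 * L + 1) <= e by rewrite -ler_pdivlMr // ge_min lexx orbT.
have s201 : 0 <= s / 2 <= 1 by apply/andP; lra.
have [r hr] := powR_polynomial_approx s201 M0 d0.
exists r => z /spectrum_positiveP [t /andP[t0 tA] ->].
rewrite horner_map /= /cpow /= -rmorphB rnorm_real //.
have tM : 0 <= t <= M by rewrite t0 /M; lra.
have h1 := hr t tM.
have -> : t `^ s = (t `^ (s / 2)) ^+ 2.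
  by rewrite -powR_mulrn ?powR_ge0 // -powRrM divfK.
rewrite horner_exp subr_sqr normrM.
have tL : t `^ (s / 2) <= L.
  by rewrite ge0_ler_powR ?nnegrE //; [lra|exact: ltW|lra].
have h2 : `|r.[t] + t `^ (s / 2)| <= 2 * L + 1.
  have -> : r.[t] + t `^ (s / 2) = (r.[t] - t `^ (s / 2)) + 2 * t `^ (s / 2) by ring.
  apply: le_trans (ler_normD _ _) _.
  rewrite [X in _ + X]ger0_norm ?mulr_ge0 ?powR_ge0 //; lra.
by apply: le_trans de; apply: ler_pM.
Qed.

Lemma poly_op_dist p q e : 0 <= e ->
  (forall z, spectrum A z -> rnorm (p.[z] - q.[z]) <= e) ->
  opnorm (poly_op p A - poly_op q A) <= e.
Proof.
move=> e0 h.
have -> : poly_op p A - poly_op q A = poly_op (p - q) A.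
  by apply/funext => x; rewrite poly_opB.
by apply: poly_op_norm_le => // z sz; rewrite !hornerE; exact: h.
Qed.

(** Uniform approximation on the spectrum makes the approximants Cauchy in operator norm, so the
    choice in [op_pow] is not the default. *)
Lemma op_pow_spec s : 0 <= s <= 1 -> bounded_op (op_pow A s) /\
  forall e, 0 < e -> exists p, (forall z, spectrum A z -> rnorm (p.[z] - cpow s z) <= e) /\
     opnorm (poly_op p A - op_pow A s) <= e.
Proof.
move=> s01.
have [bB [p [hp1 hp2]]] : [set B | bounded_op B /\ exists p : nat -> {poly R[i]},
    {uniform spectrum A, (fun k z => (p k).[z] : R[i]^o) @ \oo -->
                         (fun z => (complex.Re z `^ s)%:C : R[i]^o)} /\
    opnorm (poly_op (p k) A - B) @[k --> \oo] --> (0 : R)] (op_pow A s).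
  apply: xgetPex.
  have /choice [r hr] : forall k : nat, exists r : {poly R}, forall z, spectrum A z ->
     rnorm ((map_poly (real_complex R) (r ^+ 2)).[z] - cpow s z) <= k.+1%:R^-1.
    by move=> k; apply: cpow_approx => //; rewrite invr_gt0 ltr0Sn.
  pose p k := map_poly (real_complex R) (r k ^+ 2).
  have up e : 0 < e -> exists N, forall n, (N <= n)%N -> forall z, spectrum A z ->
      rnorm ((p n).[z] - cpow s z) <= e.
    move=> e0; have [N hN] := inv_succ_lt e0; exists N => n hn z sz.
    exact: le_trans (hr n z sz) (ltW (hN n hn)).
  have [B bB hB] : exists2 B, bounded_op B & forall e, 0 < e -> exists N, forall n, (N <= n)%N ->
     opnorm (poly_op (p n) A - B) <= e.
    apply: opnorm_cauchy => [k|e e0]; first exact: bounded_poly_op.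
    have [N hN] := up (e / 2) (divr_gt0 e0 (ltr0Sn _ 1)).
    exists N => m n hm hn; apply: poly_op_dist => //; first exact: ltW.
    move=> z sz; have := hN m hm z sz; have := hN n hn z sz.
    have := ler_rnorm_distD (cpow s z) (p m).[z] (p n).[z].
    rewrite (rnorm_distC (cpow s z)); lra.
  exists B; split=> //; exists p; split.
    by apply/cvg_uniformP.
  apply/cvgrPdist_le => e e0; have [N hN] := hB e e0.
  by exists N => // n hn; rewrite sub0r normrN ger0_norm ?opnorm_ge0 //; exact: hN.
split=> // e e0; move/cvg_uniformP: hp1 => /(_ e e0) [N1 h1].
move/cvgrPdist_le : hp2 => /(_ e e0) [N2 _ h2].
exists (p (maxn N1 N2)); split; first by apply: h1; exact: leq_maxl.
have := h2 _ (leq_maxr N1 N2); rewrite sub0r normrN ger0_norm ?opnorm_ge0 //.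
Qed.

Lemma bounded_op_pow s : 0 <= s <= 1 -> bounded_op (op_pow A s).
Proof. by move=> /op_pow_spec []. Qed.

Lemma opnorm_distD B D E : bounded_op B -> bounded_op D -> bounded_op E ->
  opnorm (B - E) <= opnorm (B - D) + opnorm (D - E).
Proof.
move=> bB bD bE.
have -> : B - E = (B - D) + (D - E) by rewrite addrA subrK.
by apply: opnorm_add; exact: bounded_sub.
Qed.

(** Independence of the sequence behind [op_pow]: p is compared with an approximant of the chosen
    limit, and polynomials that are close on the spectrum are close as operators. *)
Lemma op_pow_dist s p e : 0 <= s <= 1 -> 0 <= e ->
  (forall z, spectrum A z -> rnorm (p.[z] - cpow s z) <= e) ->
  opnorm (poly_op p A - op_pow A s) <= e.
Proof.
move=> s01 e0 hp; have [bB happ] := op_pow_spec s01.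
apply/ler_addgt0Pr => d d0; have [q [hq1 hq2]] := happ (d / 2) (divr_gt0 d0 (ltr0Sn _ 1)).
have bp : bounded_op (poly_op p A) by exact: bounded_poly_op.
have bq : bounded_op (poly_op q A) by exact: bounded_poly_op.
apply: le_trans (opnorm_distD bp bq bB) _.
have -> : e + d = (e + d / 2) + d / 2 by field.
apply: lerD => //; apply: poly_op_dist => //; first by lra.
move=> z sz; have := hp z sz; have := hq1 z sz.
have := ler_rnorm_distD (cpow s z) p.[z] q.[z].
rewrite (rnorm_distC (cpow s z)); lra.
Qed.

Lemma opnorm_op_pow s : 0 <= s <= 1 -> opnorm (op_pow A s) <= opnorm A `^ s.
Proof.
move=> s01; have [bB happ] := op_pow_spec s01; have /andP[s0 s1] := s01.
apply/ler_addgt0Pr => d d0; have [q [hq1 hq2]] := happ (d / 2) (divr_gt0 d0 (ltr0Sn _ 1)).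
have bq : bounded_op (poly_op q A) by exact: bounded_poly_op.
have -> : op_pow A s = poly_op q A - (poly_op q A - op_pow A s) by rewrite opprB addrC subrK.
apply: le_trans (opnorm_add bq (bounded_opp (bounded_sub bq bB))) _.
have h1 : opnorm (poly_op q A) <= opnorm A `^ s + d / 2.
  apply: poly_op_norm_le => //; first by rewrite addr_ge0 ?powR_ge0 // divr_ge0 // ltW.
  move=> z sz; have := hq1 z sz; have [t /andP[t0 tA] zE] := spectrum_positiveP sz.
  have := ler_rnorm_distD (cpow s z) q.[z] 0; rewrite !subr0.
  have : rnorm (cpow s z) <= opnorm A `^ s.
    by rewrite zE /cpow /= rnorm_real ger0_norm ?powR_ge0 // ge0_ler_powR // ?nnegrE // opnorm_ge0.
  lra.
have h2 : opnorm (- (poly_op q A - op_pow A s)) <= d / 2.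
  apply: le_trans hq2; rewrite -scaleN1r; apply: le_trans (opnorm_scale _ (bounded_sub bq bB)) _.
  by rewrite rnormN rnorm1 mul1r.
lra.
Qed.

Lemma positive_op_pow s : 0 <= s <= 1 -> positive_op (op_pow A s).
Proof.
move=> s01; have [bB _] := op_pow_spec s01.
have happ e : 0 < e -> exists Q, [/\ bounded_op Q, symmetric_op Q,
    forall x, 0 <= complex.Re (inner (Q x) x) &
    forall x, rnorm (op_pow A s x - Q x) <= e * rnorm x].
  move=> e0; have [r hr] := cpow_approx s01 e0.
  pose p := map_poly (real_complex R) r.
  have cp : map_poly (@conjc R) p = p.
    rewrite -map_poly_comp; apply: eq_map_poly => c /=; exact: conjc_real.
  have bQ : bounded_op (poly_op (p * p) A) by exact: bounded_poly_op.
  have pE : map_poly (real_complex R) (r ^+ 2) = p * p by rewrite rmorphXn.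
  exists (poly_op (p * p) A); split=> //.
  - by move=> x y; rewrite poly_op_adj // rmorphM /= cp.
  - by move=> x; rewrite poly_opM // poly_op_adj // cp -sqr_rnorm sqr_ge0.
  move=> x; rewrite rnorm_distC; have := opnorm_ub x (bounded_sub bQ bB); rewrite !fctE.
  move=> h; apply: (le_trans h); rewrite ler_wpM2r ?rnorm_ge0 //.
  by rewrite -pE; apply: op_pow_dist => //; exact: ltW.
split=> //.
- move=> x y; apply/eqP; rewrite -subr_eq0; apply/eqP/rnorm_eq0/le_anti.
  rewrite rnorm_ge0 andbT; apply/ler_addgt0Pr => e e0; rewrite add0r.
  pose k : R := 2 * rnorm x * rnorm y + 1.
  have k0 : 0 < k by rewrite ltr_wpDl // !mulr_ge0 ?rnorm_ge0.
  have [Q [_ sQ _ dQ]] := happ (e / k) (divr_gt0 e0 k0).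
  have -> : inner (op_pow A s x) y - inner x (op_pow A s y) =
     inner (op_pow A s x - Q x) y - inner x (op_pow A s y - Q y).
    by rewrite innerBl innerBr sQ opprB addrA subrK.
  apply: le_trans (ler_rnormB _ _) _.
  have h1 := rnorm_inner_le (op_pow A s x - Q x) y.
  have h2 := rnorm_inner_le x (op_pow A s y - Q y).
  have h3 : rnorm (op_pow A s x - Q x) * rnorm y <= e / k * rnorm x * rnorm y.
    by rewrite ler_wpM2r ?rnorm_ge0.
  have h4 : rnorm x * rnorm (op_pow A s y - Q y) <= rnorm x * (e / k * rnorm y).
    by rewrite ler_wpM2l ?rnorm_ge0.
  have -> : e = e / k * k by rewrite divfK // gt_eqF.
  have : 0 < e / k by rewrite divr_gt0.
  move: h3 h4; set d := e / k => h3 h4 d0; rewrite /k; lra.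
- move=> x; rewrite -oppr_le0; apply/ler_addgt0Pr => e e0; rewrite add0r.
  pose k : R := rnorm x ^+ 2 + 1.
  have k0 : 0 < k by rewrite ltr_wpDl // sqr_ge0.
  have [Q [_ _ pQ dQ]] := happ (e / k) (divr_gt0 e0 k0).
  have := pQ x; have -> : Q x = op_pow A s x - (op_pow A s x - Q x) by rewrite opprB addrC subrK.
  rewrite innerBl ReD ReN.
  have h1 := rnorm_inner_le (op_pow A s x - Q x) x.
  have h2 := normr_Re_le (inner (op_pow A s x - Q x) x).
  have h3 := ler_norm (- complex.Re (inner (op_pow A s x - Q x) x)); rewrite normrN in h3.
  have h4 : rnorm (op_pow A s x - Q x) * rnorm x <= e / k * rnorm x * rnorm x.
    by rewrite ler_wpM2r ?rnorm_ge0.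
  have : e / k * rnorm x * rnorm x <= e.
    rewrite -mulrA -expr2 -[leRHS](divfK (lt0r_neq0 k0)) ler_wpM2l //.
      by rewrite divr_ge0 // ltW.
    by rewrite /k lerDl.
  lra.
Qed.

(** The product of approximants of the two powers is uniformly close to the identity function on the
    spectrum, hence close to A as an operator. *)
Lemma op_pow_comp s t : 0 <= s <= 1 -> 0 <= t <= 1 -> s + t = 1 ->
  op_pow A s \o op_pow A t = A.
Proof.
move=> s01 t01 st; have [bS hS] := op_pow_spec s01; have [bT hT] := op_pow_spec t01.
have /andP[s0 s1] := s01; have /andP[t0 t1] := t01.
apply/funext => x; apply/eqP; rewrite -subr_eq0; apply/eqP/rnorm_eq0/le_anti.
rewrite rnorm_ge0 andbT.
have cE z : spectrum A z -> cpow s z * cpow t z = z.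
  move=> /spectrum_positiveP [r /andP[r0 _] ->]; rewrite /cpow -rmorphM /=; congr (_%:C).
  exact: powR_split.
set a := opnorm (op_pow A s); set b := opnorm (op_pow A t).
have a0 : 0 <= a := opnorm_ge0 _. have b0 : 0 <= b := opnorm_ge0 _.
pose c := 1 + opnorm A.
have c1 : 1 <= c by rewrite /c lerDl opnorm_ge0.
have cle r z : 0 <= r <= 1 -> spectrum A z -> rnorm (cpow r z) <= c.
  move=> /andP[r0 r1] /spectrum_positiveP [u /andP[u0 uA] ->].
  rewrite /cpow /= rnorm_real ger0_norm ?powR_ge0 //.
  have [u1|u1] := leP 1 u.
    by apply: le_trans (ler1_powR u1 r1) _; rewrite /c; lra.
  apply: le_trans c1; have E1 : (1 : R) `^ r = 1 by rewrite powR1.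
  by rewrite -E1 ge0_ler_powR // ?nnegrE // ltW.
apply/ler_addgt0Pr => e e0; rewrite add0r.
(* Three errors, each a multiple of d |x|: 2 c + 1 for the product of the polynomials against the
   identity function, b for replacing the left power by its polynomial, and a + 1, a bound on the
   norm of that polynomial, for replacing the right power. *)
pose k := (2 * c + 1 + (a + 1) + b) * (rnorm x + 1).
have k1 : 0 < 2 * c + 1 + (a + 1) + b by lra.
have x1 : 0 < rnorm x + 1 by rewrite ltr_wpDl ?rnorm_ge0.
have k0 : 0 < k by rewrite mulr_gt0.
pose d := Num.min 1 (e / k).
have d0 : 0 < d by rewrite lt_min ltr01 divr_gt0.
have d1 : d <= 1 by rewrite ge_min lexx.
have dk : d * k <= e by rewrite -ler_pdivlMr // ge_min lexx orbT.
have [p [hp1 hp2]] := hS d d0; have [q [hq1 hq2]] := hT d d0.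
have bp : bounded_op (poly_op p A) by exact: bounded_poly_op.
have bq : bounded_op (poly_op q A) by exact: bounded_poly_op.
have h1 : rnorm (poly_op p A (poly_op q A x) - A x) <= d * (2 * c + 1) * rnorm x.
  rewrite -poly_opM // -[X in _ - X]poly_opX -poly_opB.
  apply: le_trans (opnorm_ub _ (bounded_poly_op _ bA)) _.
  rewrite ler_wpM2r ?rnorm_ge0 //; apply: poly_op_norm_le => //.
    by rewrite mulr_ge0 //; [exact: ltW|lra].
  move=> z sz; rewrite !hornerE -[X in _ - X](cE z sz).
  have -> : p.[z] * q.[z] - cpow s z * cpow t z =
     (p.[z] - cpow s z) * (q.[z] - cpow t z) + (p.[z] - cpow s z) * cpow t z +
     cpow s z * (q.[z] - cpow t z) by ring.
  have u1 := hp1 z sz; have u2 := hq1 z sz; have u3 := cle s z s01 sz; have u4 := cle t z t01 sz.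
  apply: le_trans (ler_rnormD _ _) _; apply: le_trans (lerD (ler_rnormD _ _) (lexx _)) _.
  rewrite !rnormM; move: u1 u2 u3 u4.
  move: (rnorm_ge0 (p.[z] - cpow s z)) (rnorm_ge0 (q.[z] - cpow t z)).
  move: (rnorm_ge0 (cpow s z)) (rnorm_ge0 (cpow t z)).
  move: (rnorm _) (rnorm _) (rnorm _) (rnorm _) => f g h i f0 g0 h0 i0 u1 u2 u3 u4.
  have f1 := le_trans u2 d1.
  have v1 : g * f <= d * 1 by rewrite ler_pM.
  have v2 : g * h <= d * c by rewrite ler_pM.
  have v3 : i * f <= c * d by rewrite ler_pM.
  lra.
have h2 : rnorm (op_pow A s (op_pow A t x) - poly_op p A (op_pow A t x)) <= d * (b * rnorm x).
  rewrite rnorm_distC; have := opnorm_ub (op_pow A t x) (bounded_sub bp bS); rewrite !fctE.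
  move=> h; apply: (le_trans h); apply: ler_pM; rewrite ?opnorm_ge0 ?rnorm_ge0 //.
  exact: opnorm_ub.
have h3 : rnorm (poly_op p A (op_pow A t x) - poly_op p A (poly_op q A x)) <= (a + 1) * (d * rnorm x).
  rewrite -linop_sub; last exact: bounded_lin.
  apply: le_trans (opnorm_ub _ bp) _; apply: ler_pM; rewrite ?opnorm_ge0 ?rnorm_ge0 //.
    have -> : poly_op p A = op_pow A s + (poly_op p A - op_pow A s) by rewrite addrC subrK.
    by apply: le_trans (opnorm_add bS (bounded_sub bp bS)) _; rewrite lerD2l (le_trans hp2).
  rewrite rnorm_distC; have := opnorm_ub x (bounded_sub bq bT); rewrite !fctE.
  by move=> h; apply: (le_trans h); rewrite ler_wpM2r ?rnorm_ge0.
have h4 := ler_rnorm_distD (poly_op p A (op_pow A t x)) (op_pow A s (op_pow A t x)) (A x).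
have h5 := ler_rnorm_distD (poly_op p A (poly_op q A x)) (poly_op p A (op_pow A t x)) (A x).
apply: le_trans h4 _.
have : d * ((2 * c + 1 + (a + 1) + b) * rnorm x) <= d * k.
  rewrite ler_wpM2l //; first exact: ltW.
  by rewrite /k ler_wpM2l ?lerDl // ltW.
lra.
Qed.

End OpPow.

(** * Polar decomposition and Aluthge transform *)

Section Polar.
Variables (R : realType) (H : hilbertType R).
Implicit Types (S T A B D E U P : H -> H) (x y v w p : H) (z a : R[i]) (r M e s t : R).

(** U sends P y to T y, vanishes on the orthogonal complement of the range of P, and is extended by
    continuity. Its graph is [rel x p v]: p is the projection of x to the closure of the range, and
    v the limit of T y as P y tends to p. Linearity, norm and uniqueness are proved for the relation
    before U is chosen. *)
Lemma polar_exists T P : bounded_op T -> bounded_op P -> symmetric_op P ->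
  (forall x, rnorm (P x) = rnorm (T x)) ->
  exists U, [/\ bounded_op U, partial_isometry U, T = U \o P &
             forall x, U x = 0 <-> T x = 0].
Proof.
move=> bT bP sP PT; have lT := bounded_lin bT; have lP := bounded_lin bP.
pose appr p v := forall e, 0 < e -> exists y, rnorm (P y - p) < e /\ rnorm (T y - v) < e.
pose rel x p v := (forall y, inner (x - p) (P y) = 0) /\ appr p v.
have relex x : exists pv : H * H, rel x pv.1 pv.2.
  have V0 : [set P y | y in setT] 0 by exists 0 => //; exact: linop0.
  have Vlin a u v : [set P y | y in setT] u -> [set P y | y in setT] v ->
      [set P y | y in setT] (a *: u + v).
    by move=> [y1 _ <-] [y2 _ <-]; exists (a *: y1 + y2) => //; rewrite lP.
  have [p [happ horth]] := projection_exists x V0 Vlin.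
  have /choice [yn hyn] : forall n : nat, exists y, rnorm (P y - p) < n.+1%:R^-1.
    move=> n; have n0 : 0 < n.+1%:R^-1 :> R by rewrite invr_gt0 ltr0Sn.
    by have [_ [y _ <-] hy] := happ _ n0; exists y; rewrite rnorm_distC.
  have [v hv] : exists v, forall e, 0 < e -> exists N, forall n, (N <= n)%N ->
      rnorm (T (yn n) - v) < e.
    apply: rnorm_cauchy => e e0; have [N hN] := inv_succ_lt (divr_gt0 e0 (ltr0Sn _ 1)).
    exists N => m n hm hn; rewrite -linop_sub // -PT linop_sub //.
    have := lt_trans (hyn m) (hN m hm); have := lt_trans (hyn n) (hN n hn).
    have := ler_rnorm_distD p (P (yn m)) (P (yn n)); rewrite (rnorm_distC p).
    lra.
  exists (p, v); split => [y|e e0] /=; first by apply: horth; exists y.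
  have [N1 h1] := hv e e0; have [N2 h2] := inv_succ_lt e0.
  exists (yn (maxn N1 N2)); split; last by apply: h1; exact: leq_maxl.
  by apply: lt_trans (hyn _) (h2 _ _); exact: leq_maxr.
have rel_lin a x p v x' p' v' : rel x p v -> rel x' p' v' ->
    rel (a *: x + x') (a *: p + p') (a *: v + v').
  move=> [orth1 a1] [orth2 a2]; split.
    move=> y; have -> : a *: x + x' - (a *: p + p') = a *: (x - p) + (x' - p').
      by rewrite opprD addrACA scalerBr.
    by rewrite innerDl innerZl orth1 orth2 mulr0 addr0.
  move=> e e0; have a0 : 0 < rnorm a + 1 by rewrite ltr_wpDl ?rnorm_ge0.
  have d0 : 0 < e / (rnorm a + 1) by rewrite divr_gt0.
  have [y1 [h1 h1']] := a1 _ d0; have [y2 [h2 h2']] := a2 _ d0.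
  have dE : e / (rnorm a + 1) * (rnorm a + 1) = e by rewrite divfK // gt_eqF.
  have comb (q q' w w' : H) : rnorm (w - q) < e / (rnorm a + 1) ->
      rnorm (w' - q') < e / (rnorm a + 1) -> rnorm (a *: w + w' - (a *: q + q')) < e.
    move=> l1 l2; have -> : a *: w + w' - (a *: q + q') = a *: (w - q) + (w' - q').
      by rewrite opprD addrACA scalerBr.
    apply: le_lt_trans (ler_rnormD _ _) _; rewrite rnormZ -[X in _ < X]dE mulrDr mulr1.
    apply: ler_ltD => //; rewrite mulrC ler_wpM2r ?rnorm_ge0 //; exact: ltW.
  by exists (a *: y1 + y2); rewrite lP lT; split; apply: comb.
have rel_norm x p v : rel x p v -> rnorm v = rnorm p.
  move=> [_ ap]; apply/eqP; rewrite -subr_eq0 -normr_eq0; apply/eqP/le_anti.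
  rewrite normr_ge0 andbT; apply/ler_addgt0Pr => e e0; rewrite add0r.
  have [y [h1 h2]] := ap (e / 2) (divr_gt0 e0 (ltr0Sn _ 1)).
  have := PT y; have := ler_rnorm_distD (P y) p 0; have := ler_rnorm_distD p (P y) 0.
  have := ler_rnorm_distD (T y) v 0; have := ler_rnorm_distD v (T y) 0.
  rewrite !subr0 (rnorm_distC p) (rnorm_distC v) => i1 i2 i3 i4 i5.
  rewrite ler_norml; apply/andP; split; lra.
have rel_orth x p v : rel x p v -> inner (x - p) p = 0.
  move=> [horth ap]; apply: rnorm_eq0; apply: le_anti; rewrite rnorm_ge0 andbT.
  apply/ler_addgt0Pr => e e0; rewrite add0r.
  have k0 : 0 < rnorm (x - p) + 1 by rewrite ltr_wpDl ?rnorm_ge0.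
  have [y [h1 _]] := ap _ (divr_gt0 e0 k0).
  have -> : inner (x - p) p = - inner (x - p) (P y - p) by rewrite innerBr horth sub0r opprK.
  rewrite rnormN; apply: le_trans (rnorm_inner_le _ _) _.
  move: h1; rewrite ltr_pdivlMr //; have := rnorm_ge0 (P y - p); lra.
have rel_le x p v : rel x p v -> rnorm p <= rnorm x.
  move=> h; apply: rnorm_le_sqr; first exact: rnorm_ge0.
  rewrite -{1}(subrK p x) sqr_rnormD (rel_orth _ _ _ h) /= mulr0 addr0.
  by rewrite lerDr sqr_ge0.
(* The difference of two candidates is a candidate for the vector 0, hence vanishes by the norm
   bounds. *)
have rel_uniq x p v p' v' : rel x p v -> rel x p' v' -> p = p' /\ v = v'.
  move=> h h'; have := rel_lin (-1) _ _ _ _ _ _ h h'.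
  rewrite !scaleN1r addNr => h0.
  have := rel_le _ _ _ h0; rewrite rnorm0 => p0.
  have E (q q' : H) : rnorm (- q + q') <= 0 -> q = q'.
    move=> q0; apply/eqP; rewrite eq_sym -subr_eq0 addrC; apply/eqP/rnorm_eq0/le_anti.
    by rewrite q0 rnorm_ge0.
  split; apply: E => //.
  by rewrite (rel_norm _ _ _ h0).
have /choice [f hf] := relex.
pose U x := (f x).2.
have relU x : rel x (f x).1 (U x) by exact: hf.
have Uval x p v : rel x p v -> U x = v by move=> h; have [] := rel_uniq _ _ _ _ _ (relU x) h.
have U0 x : U x = 0 <-> (f x).1 = 0.
  split=> h; apply: rnorm_eq0.
    by rewrite -(rel_norm _ _ _ (relU x)) h rnorm0.
  by rewrite (rel_norm _ _ _ (relU x)) h rnorm0.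
exists U; split.
- split; first by move=> a x y; apply: Uval; exact: rel_lin (relU x) (relU y).
  by exists 1 => x; rewrite mul1r (rel_norm _ _ _ (relU x)); exact: rel_le (relU x).
- move=> x hx; set p := (f x).1.
  (* As x is orthogonal to ker U and x - p is orthogonal to p, membership of x - p in ker U forces x
     = p. *)
  have hU : U (x - p) = 0.
    apply: (Uval _ 0); split.
      by rewrite subr0; case: (relU x).
    by move=> e e0; exists 0; rewrite (linop0 lP) (linop0 lT) subr0 rnorm0.
  have ho := rel_orth _ _ _ (relU x); rewrite -/p in ho.
  have hx' := hx _ hU.
  have : x - p = 0.
    apply: rnorm_eq0; apply/eqP; rewrite -sqrf_eq0 sqr_rnorm innerBl hx' sub0r ReN.
    by rewrite Re_innerC ho oppr0.
  by rewrite (rel_norm _ _ _ (relU x)) -/p => /subr0_eq <-.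
- apply/funext => y; apply/esym/(Uval _ (P y)).
  split; first by move=> y'; rewrite subrr inner0l.
  by move=> e e0; exists y; rewrite !subrr rnorm0.
move=> x; rewrite U0; have [horth ap] := relU x; split=> h.
  rewrite h subr0 in horth; apply: rnorm_eq0; rewrite -PT; apply/eqP.
  by rewrite -sqrf_eq0 sqr_rnorm sP horth.
have Px : P x = 0 by apply: rnorm_eq0; rewrite PT h rnorm0.
apply: (rel_uniq x _ (U x) 0 0 (relU x) _).1; split.
  by move=> y; rewrite subr0 -sP Px inner0l.
by move=> e e0; exists 0; rewrite (linop0 lP) (linop0 lT) subr0 rnorm0.
Qed.

(** The isometry condition speaks of vectors orthogonal to ker U only, so x is first reduced by its
    projection to ker U. *)
Lemma partial_isometry_opnorm U : bounded_op U -> partial_isometry U -> opnorm U <= 1.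
Proof.
move=> bU pU; have lU := bounded_lin bU.
apply: opnorm_le => // x; rewrite mul1r.
have kerlin a u v : U u = 0 -> U v = 0 -> U (a *: u + v) = 0.
  by move=> hu hv; rewrite lU hu hv scaler0 addr0.
have [p [happ horth]] := @projection_exists _ _ [set x | U x = 0] x (linop0 lU) kerlin.
have Up : U p = 0.
  apply: rnorm_small_eq0 => e e0.
  have k0 : 0 < opnorm U + 1 by rewrite ltr_wpDl ?opnorm_ge0.
  have [v /= Uv hv] := happ _ (divr_gt0 e0 k0).
  rewrite -[p](subrK v) linop_add // Uv addr0; apply: le_trans (opnorm_ub _ bU) _.
  move: hv; rewrite ltr_pdivlMr //; have := rnorm_ge0 (p - v); lra.
have -> : U x = U (x - p) by rewrite linop_sub // Up subr0.
rewrite pU //; apply: rnorm_le_sqr; first exact: rnorm_ge0.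
rewrite -{2}(subrK p x) (sqr_rnormD (x - p)) (horth _ Up) /= mulr0 addr0.
by rewrite lerDl sqr_ge0.
Qed.

Lemma positive_adjoint_comp T : bounded_op T -> positive_op (adjoint T \o T).
Proof.
move=> bT; have [bS hS] := adjoint_spec bT; split.
- exact: bounded_comp.
- by move=> x y /=; rewrite -hS innerC -hS -innerC.
- by move=> x /=; rewrite Re_innerC -hS -sqr_rnorm sqr_ge0.
Qed.

Hypothesis H_neq0 : exists x : H, x != 0.

Lemma half01 : 0 <= (2^-1 : R) <= 1.
Proof. by apply/andP; lra. Qed.

(** Serves twice: for the adjoint of T times T it relates |T| to T, and for the operator G of Rota's
    renorming it computes the new norm. *)
Lemma sqr_rnorm_sqrt A x : positive_op A ->
  rnorm (op_pow A 2^-1 x) ^+ 2 = complex.Re (inner (A x) x).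
Proof.
move=> pA; have [bP sP _] := positive_op_pow H_neq0 pA half01.
have h : op_pow A 2^-1 \o op_pow A 2^-1 = A.
  by apply: op_pow_comp => //; rewrite ?half01 //; lra.
by rewrite sqr_rnorm -sP -[op_pow A 2^-1 (_ x)]/((op_pow A 2^-1 \o op_pow A 2^-1) x) h.
Qed.

Lemma positive_abs_op T : bounded_op T -> positive_op (abs_op T).
Proof. by move=> bT; apply: positive_op_pow => //; [exact: positive_adjoint_comp|exact: half01]. Qed.

Lemma rnorm_abs_op T x : bounded_op T -> rnorm (abs_op T x) = rnorm (T x).
Proof.
move=> bT; apply/eqP; rewrite -(@eqrXn2 _ 2) ?rnorm_ge0 //; apply/eqP.
rewrite sqr_rnorm_sqrt; last exact: positive_adjoint_comp.
by have [_ hS] := adjoint_spec bT; rewrite /= Re_innerC -hS sqr_rnorm.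
Qed.

Lemma polar_factor_spec T : bounded_op T ->
  [/\ bounded_op (polar_factor T), opnorm (polar_factor T) <= 1 &
      T = polar_factor T \o abs_op T].
Proof.
move=> bT; have [bP sP _] := positive_abs_op bT.
have [bU pU TU _] : [set U | [/\ bounded_op U, partial_isometry U, T = U \o abs_op T
                    & forall x, U x = 0 <-> T x = 0]] (polar_factor T).
  by apply: xgetPex; apply: polar_exists => // x; exact: rnorm_abs_op.
by split=> //; exact: partial_isometry_opnorm.
Qed.

Section Aluthge.
Variable lambda : R.
Hypothesis lambda01 : 0 <= lambda <= 1.

Let lambda01' : 0 <= 1 - lambda <= 1.
Proof. by move: lambda01 => /andP[? ?]; apply/andP; lra. Qed.

Lemma bounded_aluthge T : bounded_op T -> bounded_op (aluthge lambda T).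
Proof.
move=> bT; have [bU _ _] := polar_factor_spec bT; have pP := positive_abs_op bT.
exact: bounded_comp (bounded_comp (bounded_op_pow H_neq0 pP lambda01) bU)
  (bounded_op_pow H_neq0 pP lambda01').
Qed.

(** The exponents of the outer factors add up to 1, the partial isometry has norm at most 1, and |T|
    has norm at most that of T. *)
Lemma opnorm_aluthge T : bounded_op T -> opnorm (aluthge lambda T) <= opnorm T.
Proof.
move=> bT; have [bU nU _] := polar_factor_spec bT; have pP := positive_abs_op bT.
have bA := bounded_op_pow H_neq0 pP lambda01; have bB := bounded_op_pow H_neq0 pP lambda01'.
have nA := opnorm_op_pow H_neq0 pP lambda01; have nB := opnorm_op_pow H_neq0 pP lambda01'.
apply: le_trans (opnorm_comp (bounded_comp bA bU) bB) _.
apply: (@le_trans _ _ (opnorm (abs_op T) `^ lambda * opnorm (abs_op T) `^ (1 - lambda))).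
  apply: ler_pM => //; try exact: opnorm_ge0.
  apply: le_trans (opnorm_comp bA bU) _.
  by rewrite -[leRHS]mulr1; apply: ler_pM => //; exact: opnorm_ge0.
rewrite powR_split ?opnorm_ge0 //; last by rewrite addrC subrK.
by apply: opnorm_le (opnorm_ge0 _) _ => x; rewrite rnorm_abs_op // opnorm_ub.
Qed.

(* T and its transform are the two products of |T|^lambda and U|T|^(1-lambda). *)
Lemma spectrum_aluthge T z : bounded_op T -> z != 0 -> spectrum T z ->
  spectrum (aluthge lambda T) z.
Proof.
move=> bT z0 sz [Y iY]; apply: sz.
have [bU _ TU] := polar_factor_spec bT; have pP := positive_abs_op bT.
have bA := bounded_op_pow H_neq0 pP lambda01; have bB := bounded_op_pow H_neq0 pP lambda01'.
have [Z iZ] := inverse_swap bA (bounded_comp bU bB) z0 iY.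
exists Z; rewrite [in X in inverse_ops X _]TU.
rewrite -[X in polar_factor T \o X](op_pow_comp H_neq0 pP lambda01' lambda01) ?subrK //.
Qed.

Lemma iter_aluthge T n : bounded_op T ->
  [/\ bounded_op (iter n (aluthge lambda) T),
      opnorm (iter n (aluthge lambda) T) <= opnorm T &
      forall z, z != 0 -> spectrum T z -> spectrum (iter n (aluthge lambda) T) z].
Proof.
move=> bT; elim: n => [|n [b1 n1 s1]] //=; split.
- exact: bounded_aluthge.
- exact: le_trans (opnorm_aluthge b1) n1.
- by move=> z z0 sz; apply: spectrum_aluthge => //; exact: s1.
Qed.

End Aluthge.

End Polar.

(** * Spectral radius *)

Section SpectralRadius.
Variables (R : realType) (H : hilbertType R).
Implicit Types (S T A B D E U X Y Z : H -> H) (x y v : H) (z w a u : R[i]) (r M e s t c : R).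
Local Notation Id := (idfun : H -> H).

Lemma rnorm_complex_le (b d : R) : rnorm (b +i* d) <= `|b| + `|d|.
Proof.
rewrite -(@ler_pXn2r _ 2) ?nnegrE ?rnorm_ge0 ?addr_ge0 // sqr_rnormc /=.
rewrite -(real_normK (num_real b)) -(real_normK (num_real d)).
have := normr_ge0 b; have := normr_ge0 d; move: `|b| `|d| => p q p0 q0; nra.
Qed.

(** Meant for P z n saying that some quantity at z is at most n: local bounds become a uniform one.
    The compactness is that of the real square around the disc. *)
Lemma unit_disc_bounded (P : R[i] -> nat -> Prop) :
  (forall z, exists n e, 0 < e /\ forall w m, (n <= m)%N -> rnorm (w - z) < e ->
     rnorm w <= 1 -> P w m) ->
  exists n, forall z, rnorm z <= 1 -> P z n.
Proof.
move=> loc; pose K : set (R * R) := `[-1, 1]%classic `*` `[-1, 1]%classic.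
have /compact_near_coveringP cK : compact K by apply: compact_setX; exact: segment_compact.
have [] := cK nat \oo (fun n p => rnorm (p.1 +i* p.2) <= 1 -> P (p.1 +i* p.2) n) _.
  move=> [b d] _; have [n [e [e0 h]]] := loc (b +i* d).
  exists (ball (b, d) (e / 2), [set m | (n <= m)%N]).
    split; first by apply: nbhsx_ballx; rewrite divr_gt0.
    by exists n.
  move=> [[b' d'] m] /= [[hb hd] nm]; apply: h => //.
  have -> : b' +i* d' - (b +i* d) = (b' - b) +i* (d' - d) by [].
  apply: le_lt_trans (rnorm_complex_le _ _) _.
  by move: hb hd; rewrite -!ball_normE /= distrC (distrC d); lra.
move=> n _ /(_ n (leqnn n)) h; exists n => -[b d] zle; apply: (h (b, d)) => //=.
have := normr_Re_le (b +i* d); have := normr_Re_le ((0 +i* 1) * (b +i* d)).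
rewrite rnormM; have -> : rnorm (0 +i* 1 : R[i]) = 1.
  by apply/eqP; rewrite -(@eqrXn2 _ 2) ?rnorm_ge0 // sqr_rnormc /= expr0n /= add0r.
rewrite /= mul0r !mul1r sub0r normrN => hd hb; rewrite /K /=.
by rewrite !in_itv /= -!ler_norml (le_trans hb) // (le_trans hd).
Qed.

Lemma inverse_unique X Y Z : inverse_ops X Y -> inverse_ops X Z -> Y = Z.
Proof.
move=> [_ _ _ h] [_ _ h' _]; apply/funext => x.
by rewrite -{1}[x]/(Id x) -h' -[LHS]/((Y \o X) (Z x)) h.
Qed.

(** Says that the spectrum avoids |w| >= 1, in a form that includes z = 0. *)
Definition resolvent_on_disc T := forall z, rnorm z <= 1 ->
  exists Y, inverse_ops (Id - z *: T) Y.

Lemma resolvent_bounded T : bounded_op T -> resolvent_on_disc T ->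
  exists2 M, 0 <= M & forall z Y, rnorm z <= 1 -> inverse_ops (Id - z *: T) Y -> opnorm Y <= M.
Proof.
move=> bT res.
have [n hn] : exists n : nat, forall z, rnorm z <= 1 -> forall Y, inverse_ops (Id - z *: T) Y ->
    opnorm Y <= n%:R.
  apply: (@unit_disc_bounded (fun z n => forall Y, inverse_ops (Id - z *: T) Y -> opnorm Y <= n%:R)).
  move=> z; have [z1|z1] := leP (rnorm z) 1; last first.
    exists 0%N, (rnorm z - 1); split; first by rewrite subr_gt0.
    move=> w m _ wz w1; exfalso; move: wz w1.
    have := ler_rnorm_distD w z 0; rewrite !subr0 rnorm_distC; lra.
  have [Y iY] := res z z1.
  (* If |w - z| < 1 / K, the perturbation (w - z) T times Y has norm at most 1/2, so the inverse at
     w has norm at most 2 |Y|. *)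
  pose K := 2 * (opnorm T * opnorm Y) + 1.
  have TY0 : 0 <= opnorm T * opnorm Y by rewrite mulr_ge0 ?opnorm_ge0.
  have K0 : 0 < K by rewrite /K; lra.
  exists (Num.Def.truncn (2 * opnorm Y)).+1, K^-1; split; first by rewrite invr_gt0.
  move=> w m nm wz w1 Z iZ.
  have bE : bounded_op ((w - z) *: T) by exact: bounded_scale.
  have small : opnorm ((w - z) *: T) * opnorm Y <= 2^-1.
    apply: (@le_trans _ _ (rnorm (w - z) * opnorm T * opnorm Y)).
      by rewrite ler_wpM2r ?opnorm_ge0 ?opnorm_scale.
    have : rnorm (w - z) * K <= 1 by rewrite -ler_pdivlMr // mul1r ltW.
    have := rnorm_ge0 (w - z); rewrite /K -mulrA; nra.
  have [Z' iZ' nZ'] : exists2 Z, inverse_ops (Id - z *: T - (w - z) *: T) Z &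
     opnorm Z <= opnorm Y / (1 - opnorm ((w - z) *: T) * opnorm Y).
    by apply: inverse_perturb => //; lra.
  have E : Id - z *: T - (w - z) *: T = Id - w *: T.
    by rewrite -addrA -opprD -scalerDl [z + _]addrC subrK.
  rewrite E in iZ'; rewrite (inverse_unique iZ iZ'); apply: le_trans nZ' _.
  apply: (@le_trans _ _ (2 * opnorm Y)).
    rewrite ler_pdivrMr; last by lra.
    have := opnorm_ge0 Y; nra.
  apply: ltW; apply: lt_le_trans (truncnS_gt _) _; by rewrite ler_nat.
by exists n%:R => // z Y z1; exact: hn.
Qed.

(** The resolvent identity Y - Z = (z - w) Y T Z, with both resolvents bounded by M. *)
Lemma resolvent_lipschitz T : bounded_op T -> resolvent_on_disc T ->
  exists2 L, 0 <= L & forall z w Y Z, rnorm z <= 1 -> rnorm w <= 1 ->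
    inverse_ops (Id - z *: T) Y -> inverse_ops (Id - w *: T) Z ->
    opnorm (Y - Z) <= L * rnorm (z - w).
Proof.
move=> bT res; have [M M0 hM] := resolvent_bounded bT res.
exists (M * opnorm T * M); first by rewrite !mulr_ge0 ?opnorm_ge0.
move=> z w Y Z z1 w1 iY iZ; have [_ bY _ hY] := iY; have [_ bZ hZ _] := iZ.
apply: opnorm_le; first by rewrite !mulr_ge0 ?opnorm_ge0 ?rnorm_ge0.
move=> x.
have -> : (Y - Z) x = Y ((z - w) *: T (Z x)).
  rewrite !fctE.
  have h1 : Z x = Y ((Id - z *: T) (Z x)) by rewrite -[RHS]/((Y \o (Id - z *: T)) (Z x)) hY.
  have h2 : x = (Id - w *: T) (Z x) by rewrite -[RHS]/(((Id - w *: T) \o Z) x) hZ.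
  rewrite [X in Y X - _]h2 [X in _ - X]h1 -linop_sub; last exact: bounded_lin.
  congr (Y _); rewrite !fctE /= opprB. by rewrite [LHS]addrC addrA subrK scalerBl.
apply: le_trans (opnorm_ub _ bY) _.
rewrite rnormZ.
have a1 := hM _ _ z1 iY; have a2 := hM _ _ w1 iZ.
have a3 := opnorm_ub (Z x) bT; have a4 := opnorm_ub x bZ.
have b3 : rnorm (T (Z x)) <= opnorm T * (M * rnorm x).
  apply: le_trans a3 _; rewrite ler_wpM2l ?opnorm_ge0 //; apply: le_trans a4 _.
  by rewrite ler_wpM2r ?rnorm_ge0.
have -> : M * opnorm T * M * rnorm (z - w) * rnorm x =
   M * (rnorm (z - w) * (opnorm T * (M * rnorm x))) by ring.
apply: ler_pM => //; rewrite ?opnorm_ge0 ?mulr_ge0 ?rnorm_ge0 //.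
by rewrite ler_wpM2l ?rnorm_ge0.
Qed.

(* 2 / (1 - w^2) = 1 / (1 - w) + 1 / (1 + w) *)
Lemma inverse_average S a Y Z : bounded_op S ->
  inverse_ops (Id - a *: S) Y -> inverse_ops (Id - (- a) *: S) Z ->
  inverse_ops (Id - a ^+ 2 *: (S \o S)) ((2^-1 : R[i]) *: (Y + Z)).
Proof.
move=> bS [bD bY h1 h2] [bD' bZ h3 h4]; have lS := bounded_lin bS.
set D := Id - a *: S in bD h1 h2 *; set D' := Id - (- a) *: S in bD' h3 h4 *.
have E : Id - a ^+ 2 *: (S \o S) = D \o D'.
  apply/funext => x; rewrite /D /D' /= !fctE /= scaleNr opprK.
  by rewrite (linop_add _ _ lS) (linop_scale _ _ lS) scalerDr scalerA -expr2 opprD addrA addrK.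
have E' : Id - a ^+ 2 *: (S \o S) = D' \o D.
  apply/funext => x; rewrite /D /D' /= !fctE /= scaleNr opprK.
  by rewrite (linop_sub _ _ lS) (linop_scale _ _ lS) scalerBr scalerA -expr2 addrA subrK.
have avg x : (2^-1 : R[i]) *: (D x + D' x) = x.
  rewrite /D /D' !fctE /= scaleNr opprK addrACA addNr addr0.
  have -> : x + x = (2%:R : R[i]) *: x by rewrite scaler_nat mulr2n.
  by rewrite scalerA mulVf ?scale1r // pnatr_eq0.
split.
- by rewrite E; exact: bounded_comp.
- by apply: bounded_scale; exact: bounded_add.
- apply/funext => x; rewrite /= !fctE.
  have bDD : bounded_op (Id - a ^+ 2 *: (S \o S)) by rewrite E; exact: bounded_comp.
  rewrite -[LHS]/((Id - a ^+ 2 *: (S \o S)) (2^-1 *: (Y x + Z x))).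
  rewrite (linop_scale _ _ (bounded_lin bDD)) (linop_add _ _ (bounded_lin bDD)).
  rewrite {1}E' {1}E /= -[D (Y x)]/((D \o Y) x) h1 -[D' (Z x)]/((D' \o Z) x) h3 addrC.
  exact: avg.
- apply/funext => x.
  rewrite -[LHS]/(2^-1 *: (Y ((Id - a ^+ 2 *: (S \o S)) x) + Z ((Id - a ^+ 2 *: (S \o S)) x))).
  rewrite {1}E {1}E' /= -[Y (D _)]/((Y \o D) (D' x)) h2 -[Z (D' _)]/((Z \o D') (D x)) h4 addrC.
  exact: avg.
Qed.

Lemma iter_double T k : iter (2 ^ k.+1) T = iter (2 ^ k) T \o iter (2 ^ k) T.
Proof. by apply/funext => x; rewrite expnS mul2n -addnn iterD. Qed.

(* Averaging over square roots, the resolvents of the powers r^n T^n, n = 2^k,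
   inherit the modulus of continuity in r of the resolvent of T. *)
Lemma resolvent_power_lipschitz T L : bounded_op T -> resolvent_on_disc T ->
  0 <= L ->
  (forall z w Y Z, rnorm z <= 1 -> rnorm w <= 1 ->
    inverse_ops (Id - z *: T) Y -> inverse_ops (Id - w *: T) Z ->
    opnorm (Y - Z) <= L * rnorm (z - w)) ->
  forall k r s u, 0 <= r <= 1 -> 0 <= s <= 1 -> rnorm u = 1 -> exists Y Z,
    [/\ inverse_ops (Id - (u * (r%:C) ^+ (2 ^ k)) *: iter (2 ^ k) T) Y,
        inverse_ops (Id - (u * (s%:C) ^+ (2 ^ k)) *: iter (2 ^ k) T) Z &
        opnorm (Y - Z) <= L * `|r - s|].
Proof.
move=> bT res L0 hL k r s u /andP[r0 r1] /andP[s0 s1].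
elim: k u => [|k ih] u u1.
  have n1 t : 0 <= t -> t <= 1 -> rnorm (u * t%:C) <= 1.
    by move=> t0 t1; rewrite rnormM u1 mul1r rnorm_real ger0_norm.
  have [Y iY] := res _ (n1 r r0 r1); have [Z iZ] := res _ (n1 s s0 s1).
  exists Y, Z; split => //; apply: le_trans (hL _ _ _ _ (n1 r r0 r1) (n1 s s0 s1) iY iZ) _.
  by rewrite -mulrBr -rmorphB rnormM u1 mul1r rnorm_real.
(* The two square roots v and -v of u are averaged; this is why the induction ranges over all u of
   modulus 1. *)
pose v := sqrtC u; have vv : v ^+ 2 = u by rewrite sqrtCK.
have v1 : rnorm v = 1.
  by apply/eqP; rewrite -(@eqrXn2 _ 2) ?rnorm_ge0 // -rnormX vv u1 expr1n.
have bI : bounded_op (iter (2 ^ k) T) by exact: bounded_iter.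
have [Y [Z [iY iZ hYZ]]] := ih v v1.
have [|Y' [Z' [iY' iZ' hYZ']]] := ih (- v); first by rewrite rnormN.
have sqE t : u * t%:C ^+ (2 ^ k.+1) = (v * t%:C ^+ (2 ^ k)) ^+ 2.
  by rewrite exprMn vv -exprM expnS mulnC.
rewrite !mulNr in iY' iZ'.
exists ((2^-1 : R[i]) *: (Y + Y')), ((2^-1 : R[i]) *: (Z + Z')); split.
- by rewrite sqE iter_double; exact: inverse_average.
- by rewrite sqE iter_double; exact: inverse_average.
have [_ bY _ _] := iY; have [_ bZ _ _] := iZ; have [_ bY' _ _] := iY'; have [_ bZ' _ _] := iZ'.
rewrite -scalerBr opprD addrACA.
have b1 := bounded_sub bY bZ; have b2 := bounded_sub bY' bZ'.
apply: le_trans (opnorm_scale _ (bounded_add b1 b2)) _.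
have -> : rnorm (2^-1 : R[i]) = 2^-1.
  by rewrite rnormV -(rmorph_nat (real_complex R)) rnorm_real ger0_norm.
have := opnorm_add b1 b2; lra.
Qed.

(** With F = Y - 1 one has E = F - F E, hence |E| <= e + e |E|. *)
Lemma inverse_close_to_id E Y e : bounded_op E -> inverse_ops (Id - E) Y ->
  opnorm (Y - Id) <= e -> e < 1 -> opnorm E <= e / (1 - e).
Proof.
move=> bE [_ bY _ h] hY e1.
have bF : bounded_op (Y - Id) by apply: bounded_sub => //; exact: bounded_id.
have e0 : 0 <= e := le_trans (opnorm_ge0 _) hY.
apply: opnorm_le => [|x]; first by rewrite divr_ge0 // subr_ge0 ltW.
have hx : E x = (Y - Id) x - (Y - Id) (E x).
  have lY := bounded_lin bY.
  have YE : Y x = x + Y (E x).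
    by apply/eqP; rewrite -subr_eq -(linop_sub _ _ lY); apply/eqP; exact: (congr1 (@^~ x) h).
  by rewrite !fctE /= YE opprB [x + _]addrC addrK addrC subrK.
have h1 := opnorm_ub x bF; have h2 := opnorm_ub (E x) bF.
have h3 := ler_rnormB ((Y - Id) x) ((Y - Id) (E x)); rewrite -hx in h3.
have h4 : opnorm (Y - Id) * rnorm x <= e * rnorm x by rewrite ler_wpM2r ?rnorm_ge0.
have h5 : opnorm (Y - Id) * rnorm (E x) <= e * rnorm (E x) by rewrite ler_wpM2r ?rnorm_ge0.
rewrite mulrAC ler_pdivlMr ?subr_gt0 //; lra.
Qed.

Lemma opnorm_iter_double T k : bounded_op T ->
  opnorm (iter (2 ^ k.+1) T) <= opnorm (iter (2 ^ k) T) ^+ 2.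
Proof. by move=> bT; rewrite iter_double expr2; apply: opnorm_comp; exact: bounded_iter. Qed.

(* The Lipschitz bound lets P below propagate from r = 0 to r = 1 by steps of a
   fixed size. *)
Lemma power_bounded T : bounded_op T -> resolvent_on_disc T ->
  exists2 N, (0 < N)%N & opnorm (iter N T) <= 1.
Proof.
move=> bT res; have [L L0 hL] := resolvent_lipschitz bT res.
have lip := resolvent_power_lipschitz bT res L0 hL.
(* The constants close up: norm 1/5 at s puts the inverse within (1/5) / (4/5) = 1/4 of 1; a step
   adds 1/20, giving 3/10 at r; so the power at r has norm at most (3/10) / (7/10) = 3/7, and
   doubling the exponent squares this to 9/49 < 1/5. *)
pose P r := exists k : nat, r ^+ (2 ^ k) * opnorm (iter (2 ^ k) T) <= 5^-1.
have P0 : P 0 by exists 0%N; rewrite expr1 mul0r invr_ge0.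
have step r s : 0 <= s <= 1 -> 0 <= r <= 1 -> L * `|r - s| <= 20^-1 -> P s -> P r.
  move=> s01 r01 rs [k hk]; have /andP[s0 s1] := s01; have /andP[r0 r1] := r01.
  have [Y [Z [iY iZ hYZ]]] := lip k r s 1 r01 s01 (rnorm1 R).
  rewrite !mul1r in iY iZ.
  have bI : bounded_op (iter (2 ^ k) T) by exact: bounded_iter.
  have bEs : bounded_op (s%:C ^+ (2 ^ k) *: iter (2 ^ k) T) by exact: bounded_scale.
  have bEr : bounded_op (r%:C ^+ (2 ^ k) *: iter (2 ^ k) T) by exact: bounded_scale.
  have scn t (t0 : 0 <= t) : rnorm (t%:C ^+ (2 ^ k)) = t ^+ (2 ^ k).
    by rewrite rnormX rnorm_real ger0_norm.
  have nEs : opnorm (s%:C ^+ (2 ^ k) *: iter (2 ^ k) T) <= 5^-1.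
    by apply: le_trans (opnorm_scale _ bI) _; rewrite scn.
  have [_ bY _ _] := iY; have [bDs bZ _ hZ] := iZ.
  have nZ : opnorm (Z - Id) <= 4^-1.
    apply: opnorm_le => [|x]; first by rewrite invr_ge0.
    set Es := _ *: iter _ T in iZ nEs bEs hZ *.
    have n1 : opnorm Z <= (1 - 5^-1)^-1.
      have [Z' iZ' nZ'] : exists2 Y, inverse_ops (Id - Es) Y & opnorm Y <= (1 - 5^-1)^-1.
        apply: neumann => // [|x']; first by apply/andP; lra.
        apply: le_trans (opnorm_ub _ bEs) _; by rewrite ler_wpM2r ?rnorm_ge0.
      by rewrite (inverse_unique iZ iZ').
    have -> : (Z - Id) x = Z (Es x).
      have lZ := bounded_lin bZ.
      rewrite !fctE /=; apply/eqP; rewrite subr_eq addrC -subr_eq -linop_sub //; apply/eqP.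
      exact: (congr1 (@^~ x) hZ).
    apply: le_trans (opnorm_ub _ bZ) _; apply: (@le_trans _ _ ((1 - 5^-1)^-1 * (5^-1 * rnorm x))).
      apply: ler_pM; rewrite ?opnorm_ge0 ?rnorm_ge0 //.
      by apply: le_trans (opnorm_ub _ bEs) _; rewrite ler_wpM2r ?rnorm_ge0.
    rewrite mulrA ler_wpM2r ?rnorm_ge0 //.
    have -> : (1 - 5^-1)^-1 * 5^-1 = 4^-1 :> R by field.
    by [].
  have nY : opnorm (Y - Id) <= 3 / 10.
    have -> : Y - Id = (Y - Z) + (Z - Id) by rewrite addrA subrK.
    apply: le_trans (opnorm_add (bounded_sub bY bZ) (bounded_sub bZ (bounded_id H))) _.
    lra.
  have nEr : opnorm (r%:C ^+ (2 ^ k) *: iter (2 ^ k) T) <= 3 / 7.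
    have -> : 3 / 7 = (3 / 10) / (1 - 3 / 10) :> R by field.
    apply: inverse_close_to_id iY nY _ => //; lra.
  have nTr : r ^+ (2 ^ k) * opnorm (iter (2 ^ k) T) <= 3 / 7.
    have [rz|rn] := eqVneq (r ^+ (2 ^ k)) 0; first by rewrite rz mul0r divr_ge0.
    have rp : 0 < r ^+ (2 ^ k) by rewrite lt_def rn exprn_ge0.
    rewrite mulrC -ler_pdivlMr //; apply: opnorm_le => [|x].
      by rewrite !divr_ge0 // ltW.
    rewrite mulrAC ler_pdivlMr // mulrC -(scn r) // -rnormZ.
    exact: le_trans (opnorm_ub x bEr) (ler_wpM2r (rnorm_ge0 _) nEr).
  exists k.+1; apply: (@le_trans _ _ ((r ^+ (2 ^ k) * opnorm (iter (2 ^ k) T)) ^+ 2)).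
    have -> : r ^+ (2 ^ k.+1) = (r ^+ (2 ^ k)) ^+ 2 by rewrite -exprM expnS mulnC.
    by rewrite exprMn ler_wpM2l ?sqr_ge0 //; exact: opnorm_iter_double.
  apply: (@le_trans _ _ ((3 / 7) ^+ 2)); last by lra.
  by rewrite ler_pXn2r ?nnegrE ?mulr_ge0 ?exprn_ge0 ?opnorm_ge0 ?divr_ge0.
(* The number of steps depends on L only, while k may grow by one at each of them. *)
have [n n0 hn] : exists2 n : nat, 0 < n%:R :> R & L / n%:R <= 20^-1.
  exists (Num.Def.truncn (20 * L)).+1; first exact: ltr0Sn.
  rewrite ler_pdivrMr ?ltr0Sn // mulrC ler_pdivlMr // mulrC; apply: ltW; exact: truncnS_gt.
have walk j : (j <= n)%N -> P (j%:R / n%:R).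
  elim: j => [|j ih] jn; first by rewrite mul0r.
  have in01 i : (i <= n)%N -> 0 <= (i%:R / n%:R : R) <= 1.
    by move=> li; rewrite divr_ge0 //= ler_pdivrMr // mul1r ler_nat.
  apply: step (in01 _ (ltnW jn)) (in01 _ jn) _ (ih (ltnW jn)).
  rewrite -mulrBl -natr1 addrAC subrr add0r mul1r ger0_norm ?invr_ge0 //.
have [k] := walk n (leqnn n); rewrite divff ?gt_eqF // expr1n mul1r => hk.
by exists (2 ^ k)%N; [rewrite expn_gt0|lra].
Qed.

End SpectralRadius.

(** * Rota's similarity, normaloid operators and numerical radius *)

Section Normaloid.
Variables (R : realType) (H : hilbertType R).
Implicit Types (S T A B D X Y Z G : H -> H) (x y v : H) (z w a : R[i]) (r M e s t c : R).
Local Notation Id := (idfun : H -> H).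
Hypothesis H_neq0 : exists x : H, x != 0.

(** G is the sum over k < n of the adjoint of T^k times T^k; its square root will be Rota's
    similarity. *)
Lemma positive_sum_powers T n : bounded_op T -> exists2 G, positive_op G &
  forall x, complex.Re (inner (G x) x) = \sum_(k < n) rnorm (iter k T x) ^+ 2.
Proof.
move=> bT; elim: n => [|n [G [bG sG pG] hG]].
  exists (0 : H -> H) => [|x]; last by rewrite big_ord0 inner0l.
  split; first exact: bounded_zero.
    by move=> x y; rewrite inner0l inner0r.
  by move=> x; rewrite inner0l.
have bI : bounded_op (iter n T) by exact: bounded_iter.
have [bE sE pE] := positive_adjoint_comp bI.
exists (G + (adjoint (iter n T) \o iter n T)).
  split; first exact: bounded_add.
    by move=> x y; rewrite !fctE innerDl innerDr sG -[adjoint _ _]/((adjoint (iter n T) \o iter n T) x) sE.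
  by move=> x; rewrite !fctE innerDl ReD addr_ge0 //; exact: pE.
move=> x; rewrite big_ord_recr /= -hG !fctE innerDl ReD; congr (_ + _).
by have [_ hS] := adjoint_spec bI; rewrite Re_innerC -hS sqr_rnorm.
Qed.

(** X commutes with its square, hence with the inverse W of the square. *)
Lemma inverse_of_square X W : bounded_op X -> inverse_ops (X \o X) W ->
  inverse_ops X (X \o W).
Proof.
move=> bX [_ bW h1 h2]; split => //; first exact: bounded_comp.
have E x : X (W x) = W (X x).
  have xE : x = X (X (W x)) by rewrite -[RHS]/(((X \o X) \o W) x) h1.
  by rewrite [in RHS]xE -[RHS]/((W \o (X \o X)) (X (W x))) h2.
apply/funext => x /=; rewrite E -[LHS]/((W \o (X \o X)) x) h2 //.
Qed.

(* Rota's renorming: for N with |T^N| <= 1, the norm of X x is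
   (|x|^2 + |T x|^2 + ... + |T^(N-1) x|^2)^(1/2), and T is a contraction for it. *)
Lemma similar_to_contraction T N : bounded_op T -> (0 < N)%N ->
  opnorm (iter N T) <= 1 ->
  exists X Y, inverse_ops X Y /\ opnorm (X \o T \o Y) <= 1.
Proof.
move=> bT N0 hN; have [G pG hG] := positive_sum_powers N bT.
pose X := op_pow G 2^-1.
have [bX _ _] := positive_op_pow H_neq0 pG (half01 R).
have XX : X \o X = G by apply: op_pow_comp; rewrite ?half01 //; lra.
have nX x : rnorm (X x) ^+ 2 = \sum_(k < N) rnorm (iter k T x) ^+ 2.
  by rewrite sqr_rnorm_sqrt.
have [W iW] : exists W, inverse_ops G W.
  have [bG _ _] := pG.
  (* The term k = 0 of the sum is |x|^2, present because N > 0, so G is coercive with constant 1. *)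
  apply: (inverse_coercive bG (rnorm1 R) ltr01) => x; rewrite !mul1r hG.
  by case: N N0 {hN hG nX} => // N _; rewrite big_ord_recl /= lerDl sumr_ge0 // => i _; exact: sqr_ge0.
have iX : inverse_ops X (X \o W) by apply: inverse_of_square => //; rewrite XX.
exists X, (X \o W); split=> //.
have key x : rnorm (X (T x)) <= rnorm (X x).
  apply: rnorm_le_sqr; first exact: rnorm_ge0.
  rewrite !nX; case: N N0 hN {hG nX} => // N _ hN.
  (* The sums for T x and for x share all other terms; what remains is the top power applied to x
     against |x|^2. *)
  rewrite big_ord_recr [X in _ <= X]big_ord_recl /= addrC; apply: lerD.
    rewrite ler_pXn2r ?nnegrE ?rnorm_ge0 // -iterSr.
    apply: le_trans (opnorm_ub _ (bounded_iter N.+1 bT)) _.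
    by rewrite ler_piMl ?rnorm_ge0.
  by apply: ler_sum => i _; rewrite -iterSr.
apply: opnorm_le => // x; rewrite mul1r /=; apply: le_trans (key _) _.
by have [_ _ h _] := iX; rewrite -[X (X _)]/((X \o (X \o W)) x) h.
Qed.

Lemma spectrum_le_radius T z : bounded_op T -> spectrum T z -> rnorm z <= spectral_radius T.
Proof.
move=> bT sz; apply: ub_le_sup; last by exists z.
by exists (opnorm T) => _ [w sw <-]; exact: spectrum_le_opnorm.
Qed.

(** An empty spectrum would give the default supremum 0, whence the assumption 0 <= M. *)
Lemma spectral_radius_le T M : 0 <= M -> (forall z, spectrum T z -> rnorm z <= M) ->
  spectral_radius T <= M.
Proof.
move=> M0 hM; rewrite /spectral_radius.
have [[r hr]|h] := pselect ([set rnorm z | z in spectrum T] !=set0).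
  by apply: ge_sup; [exists r|move=> _ [z sz <-]; exact: hM].
by rewrite sup_out // => -[].
Qed.

Lemma spectral_radius_ge0 T : 0 <= spectral_radius T.
Proof.
rewrite /spectral_radius.
have [hs|hs] := pselect (has_sup [set rnorm z | z in spectrum T]); last by rewrite sup_out.
have [[_ [z sz _]] hub] := hs.
by apply: le_trans (rnorm_ge0 z) (ub_le_sup hub _); exists z.
Qed.

Lemma inverse_id : inverse_ops Id Id.
Proof. by split=> //; exact: bounded_id. Qed.

(** For nonzero z, 1 - z T / c = -(z / c) (T - c / z), and |c / z| >= c on the unit disc. *)
Lemma resolvent_on_disc_scale T c : 0 < c ->
  (forall z, c <= rnorm z -> ~ spectrum T z) -> resolvent_on_disc ((c^-1)%:C *: T).
Proof.
move=> c0 hc z z1; have [->|z0] := eqVneq z 0.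
  by exists Id; rewrite scale0r subr0; exact: inverse_id.
have cc0 : c%:C != 0 :> R[i] by rewrite eq_complex /= gt_eqF.
have [Y iY] : exists Y, inverse_ops (T - (c%:C / z) *: Id) Y.
  apply: contrapT; apply: hc; rewrite rnormM rnormV rnorm_real gtr0_norm //.
  have zp : 0 < rnorm z.
    by rewrite lt_def rnorm_ge0 andbT; apply: contra z0 => /eqP /rnorm_eq0 ->.
  by rewrite ler_pdivlMr // ler_piMr // ltW.
have k0 : - (z / c%:C) != 0 by rewrite oppr_eq0 mulf_neq0 ?invr_eq0.
exists ((- (z / c%:C))^-1 *: Y).
have -> : Id - z *: ((c^-1)%:C *: T) = (- (z / c%:C)) *: (T - (c%:C / z) *: Id).
  apply/funext => x; rewrite !fctE /= scalerBr !scalerA fmorphV mulNr.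
  have -> : z / c%:C * (c%:C / z) = 1 by field; rewrite z0 cc0.
  by rewrite !scaleNr scale1r opprK addrC.
exact: inverse_scale.
Qed.

Lemma similarity_opnorm T c : bounded_op T -> spectral_radius T < c ->
  exists X Y, inverse_ops X Y /\ opnorm (X \o T \o Y) <= c.
Proof.
move=> bT rc; have c0 : 0 < c := le_lt_trans (spectral_radius_ge0 T) rc.
have bcT : bounded_op ((c^-1)%:C *: T) by exact: bounded_scale.
have res : resolvent_on_disc ((c^-1)%:C *: T).
  apply: resolvent_on_disc_scale => // z cz sz.
  by have := lt_le_trans rc cz; rewrite ltNge spectrum_le_radius.
have [N N0 hN] := power_bounded bcT res.
have [X [Y [iXY nXY]]] := similar_to_contraction bcT N0 hN.
exists X, Y; split=> //; have [bX bY _ _] := iXY.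
have cc0 : c%:C != 0 :> R[i] by rewrite eq_complex /= gt_eqF.
have -> : X \o T \o Y = c%:C *: (X \o ((c^-1)%:C *: T) \o Y).
  apply/funext => x; rewrite /= !fctE (linop_scale _ _ (bounded_lin bX)) scalerA.
  by rewrite fmorphV divff // scale1r.
have bXTY : bounded_op (X \o ((c^-1)%:C *: T) \o Y) by do 2 apply: bounded_comp => //.
apply: le_trans (opnorm_scale _ bXTY) _.
by rewrite rnorm_real gtr0_norm // ler_piMr // ltW.
Qed.

(** If the circle of radius m = |T| were free of spectrum, a uniform resolvent bound would free an
    annulus m' < |z| with m' < m, against r(T) = m. *)
Lemma normaloid_spectrum T : bounded_op T -> normaloid T -> 0 < opnorm T ->
  exists2 z, spectrum T z & rnorm z = opnorm T.
Proof.
move=> bT nT m0; set m := opnorm T in m0 *; apply: contrapT => h.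
have out z : m <= rnorm z -> ~ spectrum T z.
  move=> mz sz; apply: h; exists z => //; apply: le_anti.
  by rewrite mz spectrum_le_opnorm.
have bmT : bounded_op ((m^-1)%:C *: T) by exact: bounded_scale.
have res := resolvent_on_disc_scale m0 out.
have [M M0 hM] := resolvent_bounded bmT res.
have nm : opnorm ((m^-1)%:C *: T) <= 1.
  apply: le_trans (opnorm_scale _ bT) _.
  by rewrite rnorm_real ger0_norm ?invr_ge0 ?mulVf ?gt_eqF // ltW.
pose K := M + 1; have K0 : 0 < K by rewrite /K; lra.
(* Chosen so that |z| > m' means m / |z| - 1 < 1 / K, a perturbation that a resolvent of norm at
   most M < K tolerates. *)
pose m' := m / (1 + K^-1).
have K1 : 0 < 1 + K^-1 by rewrite addr_gt0 ?invr_gt0.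
have m'0 : 0 < m' by rewrite divr_gt0.
have : m <= m'.
  rewrite -[X in X <= _]nT; apply: spectral_radius_le; first exact: ltW.
  move=> z sz; have zm := spectrum_le_opnorm bT sz.
  have [zm'|zm'] := leP (rnorm z) m' => //; exfalso; apply: sz.
  have z0 : 0 < rnorm z := lt_trans m'0 zm'.
  have zn0 : z != 0 by apply: contraTneq z0 => ->; rewrite rnorm0 ltxx.
  (* m / z = (1 + d) w0 with |w0| = 1, so T - z is -z times 1 - w0 T / m perturbed by d w0 T / m. *)
  pose w0 := (rnorm z)%:C / z.
  have zc0 : (rnorm z)%:C != 0 :> R[i] by rewrite eq_complex /= gt_eqF.
  have w01 : rnorm w0 = 1.
    by rewrite rnormM rnormV rnorm_real ger0_norm ?rnorm_ge0 // divff // gt_eqF.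
  have w0le : rnorm w0 <= 1 by rewrite w01.
  have [Y iY] := res w0 w0le; have nY := hM _ _ w0le iY.
  pose d := m / rnorm z - 1.
  have d0 : 0 <= d.
    by rewrite subr_ge0 ler_pdivlMr // mul1r.
  have dK : d * K < 1.
    have : m < rnorm z * (1 + K^-1) by rewrite -ltr_pdivrMr.
    by rewrite mulrC -ltr_pdivrMr // => h1; rewrite -ltr_pdivlMr // mul1r /d ltrBlDl.
  have bE : bounded_op ((d%:C * w0) *: ((m^-1)%:C *: T)) by exact: bounded_scale.
  have [Z iZ _] : exists2 Z, inverse_ops (Id - w0 *: ((m^-1)%:C *: T) - (d%:C * w0) *: ((m^-1)%:C *: T)) Z &
      opnorm Z <= opnorm Y / (1 - opnorm ((d%:C * w0) *: ((m^-1)%:C *: T)) * opnorm Y).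
    apply: inverse_perturb => //.
    apply: (@le_lt_trans _ _ (d * M)).
      apply: ler_pM; rewrite ?opnorm_ge0 //.
      apply: le_trans (opnorm_scale _ bmT) _.
      by rewrite rnormM w01 mulr1 rnorm_real ger0_norm // ler_piMr.
    by move: dK; rewrite /K; lra.
  have k0 : - z != 0 by rewrite oppr_eq0.
  exists ((- z)^-1 *: Z).
  have -> : T - z *: Id =
    (- z) *: (Id - w0 *: ((m^-1)%:C *: T) - (d%:C * w0) *: ((m^-1)%:C *: T)).
    apply/funext => x; rewrite !fctE /= -addrA -opprD !scalerA -scalerDl scalerBr scalerA.
    have -> : - z * (w0 * (m^-1)%:C + d%:C * w0 * (m^-1)%:C) = -1.
      rewrite /w0 /d rmorphB rmorphM /= !fmorphV rmorph1.
      have mc0 : m%:C != 0 :> R[i] by rewrite eq_complex /= gt_eqF.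
      by field; rewrite zn0 zc0 mc0.
    by rewrite scaleN1r opprK scaleNr addrC.
  exact: inverse_scale.
rewrite ler_pdivlMr //; have : 0 < m * K^-1 by rewrite mulr_gt0 ?invr_gt0.
lra.
Qed.

(** * Rotations, real parts and the numerical radius *)

Lemma expi_surj z : rnorm z = 1 -> exists theta, expi theta = z.
Proof.
case: z => b d z1.
have e1 : b ^+ 2 + d ^+ 2 = 1 by have := sqr_rnormc (b +i* d); rewrite z1 expr1n.
have b1 : -1 <= b <= 1.
  by rewrite -ler_norml; apply: le_trans (normr_Re_le (b +i* d)) _; rewrite z1.
have sE : sin (acos b) = `|d|.
  rewrite sin_acos; first by rewrite -sqrtr_sqr; congr Num.sqrt; lra.
  by case/andP: b1 => ? ?; apply/andP.
have [d0|d0] := leP 0 d.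
  exists (acos b); rewrite /expi acosK ?sE ?ger0_norm //.
exists (- acos b); rewrite /expi cosN sinN acosK ?sE //.
by rewrite ltr0_norm // opprK.
Qed.

Lemma rnorm_expi (theta : R) : rnorm (expi theta) = 1.
Proof.
by apply/eqP; rewrite -(@eqrXn2 _ 2) ?rnorm_ge0 // sqr_rnormc /= cos2Dsin2 expr1n.
Qed.

Lemma bounded_real_part S : bounded_op S -> bounded_op (real_part S).
Proof.
by move=> bS; apply: bounded_scale; apply: bounded_add => //; case: (adjoint_spec bS).
Qed.

Lemma opnorm_real_part S : bounded_op S -> opnorm (real_part S) <= opnorm S.
Proof.
move=> bS; have [bA _] := adjoint_spec bS.
apply: le_trans (opnorm_scale _ (bounded_add bS bA)) _.
have -> : rnorm (2^-1 : R[i]) = 2^-1.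
  by rewrite rnormV -(rmorph_nat (real_complex R)) rnorm_real ger0_norm.
have := opnorm_add bS bA; have := opnorm_adjoint bS; lra.
Qed.

Lemma inner_real_part S x : bounded_op S ->
  inner (real_part S x) x = (complex.Re (inner (S x) x))%:C.
Proof.
move=> bS; have [_ hS] := adjoint_spec bS.
rewrite /real_part !fctE innerZl innerDl (innerC (adjoint S x)) -hS.
by rewrite ReJ_add mulrC.
Qed.

Lemma numerical_range_bounded S : bounded_op S ->
  ubound [set rnorm z | z in numerical_range S] (opnorm S).
Proof.
move=> bS _ [_ [x /= x1 <-] <-]; apply: le_trans (rnorm_inner_le _ _) _.
by rewrite x1 mulr1; have := opnorm_ub x bS; rewrite x1 mulr1.
Qed.

Lemma unit_vector_exists : exists x : H, rnorm x = 1.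
Proof.
have [x x0] := H_neq0; exists (((rnorm x)^-1)%:C *: x).
rewrite rnormZ rnorm_real ger0_norm ?invr_ge0 ?rnorm_ge0 // mulVf //.
by apply: contra x0 => /eqP /rnorm_eq0 ->.
Qed.

Lemma numerical_range_nonempty S : [set rnorm z | z in numerical_range S] !=set0.
Proof.
have [x x1] := unit_vector_exists.
by exists (rnorm (inner (S x) x)), (inner (S x) x) => //; exists x.
Qed.

Lemma numerical_radius_le_opnorm S : bounded_op S -> numerical_radius S <= opnorm S.
Proof.
by move=> bS; apply: ge_sup (numerical_range_nonempty S) (numerical_range_bounded bS).
Qed.

Lemma spectrum_le_numerical_radius S r : bounded_op S -> spectrum S r%:C ->
  r <= numerical_radius (real_part S).
Proof.
move=> bS sr; set w := numerical_radius _.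
have bRe := bounded_real_part bS.
have hw x : complex.Re (inner (S x) x) <= w * rnorm x ^+ 2.
  have [x0|x0] := eqVneq (rnorm x) 0.
    by rewrite (rnorm_eq0 x0) inner0r rnorm0 expr0n mulr0.
  have xp : 0 < rnorm x by rewrite lt_def x0 rnorm_ge0.
  pose y := ((rnorm x)^-1)%:C *: x.
  have y1 : rnorm y = 1 by rewrite rnormZ rnorm_real ger0_norm ?invr_ge0 ?rnorm_ge0 ?mulVf.
  have : rnorm (inner (real_part S y) y) <= w.
    apply: ub_le_sup; first by exists (opnorm (real_part S)); exact: numerical_range_bounded.
    by exists (inner (real_part S y) y) => //; exists y.
  rewrite inner_real_part // rnorm_real => /(le_trans (ler_norm _)).
  rewrite /y (linop_scale _ _ (bounded_lin bS)) innerZl innerZr conjc_real !ReZ mulrA -expr2.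
  by rewrite exprVn mulrC ler_pdivrMr // exprn_gt0.
rewrite -subr_le0.
apply: (@spectrum_not_coercive _ _ S r%:C (-1) _ bS sr); first by rewrite rnormN rnorm1.
move=> x; rewrite mulN1r opprB ReD ReN ReZ /=; have := hw x; lra.
Qed.

Lemma numerical_radius_ge0 S : 0 <= numerical_radius S.
Proof.
rewrite /numerical_radius.
have [hs|hs] := pselect (has_sup [set rnorm z | z in numerical_range S]); last by rewrite sup_out.
have [[_ [z sz _]] hub] := hs.
by apply: le_trans (rnorm_ge0 z) (ub_le_sup hub _); exists z.
Qed.

(** T - z = a^-1 Y (a X T Y - a z) X, so an inverse of the middle factor would yield one of T -
    z. *)
Lemma spectrum_similar T X Y a z : inverse_ops X Y -> a != 0 -> spectrum T z ->
  spectrum (a *: (X \o T \o Y)) (a * z).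
Proof.
move=> iXY a0 sz [W iW]; apply: sz; have [bX bY hXY hYX] := iXY.
have lY := bounded_lin bY.
have := inverse_scale (invr_neq0 a0) (inverse_comp (inverse_comp (inverse_sym iXY) iW) iXY).
move=> iZ; exists (a^-1^-1 *: (Y \o (W \o X))).
have YX x : Y (X x) = x by rewrite -[LHS]/((Y \o X) x) hYX.
congr (inverse_ops _ _): iZ; apply/funext => x; rewrite /= !fctE /= YX.
rewrite (linop_sub _ _ lY) !(linop_scale _ _ lY) !YX scalerBr !scalerA mulVf // scale1r.
by rewrite mulrA mulVf // mul1r.
Qed.

End Normaloid.

Theorem corollary3p1 (R : realType) (H : hilbertType R)
    (H_neq0 : exists x : H, x != 0)
    (lambda : R) (lambda01 : 0 <= lambda <= 1)
    (T : H -> H) (HT : bounded_op T) (n : nat) :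
  [<-> normaloid T;
       exists theta : R, forall X Y : H -> H, inverse_ops X Y ->
         opnorm T <= numerical_radius (real_part
           (iter n (aluthge lambda) (expi theta *: (X \o T \o Y))));
       exists theta : R, forall X Y : H -> H, inverse_ops X Y ->
         opnorm T <= opnorm (real_part
           (iter n (aluthge lambda) (expi theta *: (X \o T \o Y)))) ].
Proof.
have bS theta X Y : inverse_ops X Y -> bounded_op (expi theta *: (X \o T \o Y)).
  by move=> [bX bY _ _]; apply: bounded_scale; do 2 apply: bounded_comp => //.
tfae.
(* The case |T| = 0 is split off because the transform is known to keep nonzero spectral values only
   and the rotation divides by z. There any theta works, a numerical radius being nonnegative. *)
- move=> nT; have [m0|m_le0] := ltP 0 (opnorm T); last first.
    exists 0 => X Y _; apply: le_trans m_le0 _; exact: numerical_radius_ge0.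
  have [z sz zE] := normaloid_spectrum HT nT m0.
  have mc0 : (opnorm T)%:C != 0 :> R[i] by rewrite eq_complex /= gt_eqF.
  have z0 : z != 0 by apply: contraTneq m0 => zz; rewrite -zE zz rnorm0 ltxx.
  have [theta thetaE] : exists theta, expi theta = (opnorm T)%:C / z.
    by apply: expi_surj; rewrite rnormM rnormV zE rnorm_real ger0_norm ?opnorm_ge0 // divff // gt_eqF.
  exists theta => X Y iXY.
  have [bD _ sD] := iter_aluthge H_neq0 lambda01 n (bS theta X Y iXY).
  apply: spectrum_le_numerical_radius => //; apply: sD => //.
  have -> : (opnorm T)%:C = expi theta * z by rewrite thetaE divfK.
  by apply: spectrum_similar => //; rewrite thetaE mulf_neq0 ?invr_eq0.
- move=> [theta h]; exists theta => X Y iXY.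
  have [bD _ _] := iter_aluthge H_neq0 lambda01 n (bS theta X Y iXY).
  apply: le_trans (h X Y iXY) (numerical_radius_le_opnorm H_neq0 _).
  exact: bounded_real_part.
- move=> [theta h]; rewrite /normaloid; apply: le_anti; apply/andP; split.
    by apply: spectral_radius_le (opnorm_ge0 _) _ => z; exact: spectrum_le_opnorm.
  (* The infimum of |X T X^-1| over all similarities need not be attained, so r(T) is approached by
     r(T) + e. *)
  apply/ler_addgt0Pr => e e0.
  have rc : spectral_radius T < spectral_radius T + e by rewrite ltrDl.
  have [X [Y [iXY nXY]]] := similarity_opnorm H_neq0 HT rc.
  have [bX bY _ _] := iXY.
  have [bD nD _] := iter_aluthge H_neq0 lambda01 n (bS theta X Y iXY).
  apply: le_trans (h X Y iXY) _; apply: le_trans (opnorm_real_part bD) _.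
  apply: le_trans nD _.
  have bXTY : bounded_op (X \o T \o Y) by do 2 apply: bounded_comp => //.
  by apply: le_trans (opnorm_scale _ bXTY) _; rewrite rnorm_expi mul1r.
Qed.
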